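(* Let $R$ be a nonzero ring. Then $R$ is a left completely virtually semisimple ring if and only if there is a ring isomorphism $R\cong\prod_{i=1}^{k}M_{n_i}(D_i)$ for some positive integers $k,n_1,\dots,n_k$ and some principal left ideal domains $D_1,\dots,D_k$. Moreover, the integers $k,n_1,\dots,n_k$ and the principal left ideal domains $D_1,\dots,D_k$ are uniquely determined by $R$ up to isomorphism (and order): if also $R\cong\prod_{j=1}^{r}M_{m_j}(D'_j)$ with $r,m_1,\dots,m_r$ positive integers and each $D'_j$ a principal left ideal domain, then $r=k$ and there is a permutation $\xi$ of $\{1,\dots,k\}$ such that $n_i=m_{\xi(i)}$ and $D_i\cong D'_{\xi(i)}$ as rings for every $i$.
   Context: All rings are associative with identity (not necessarily commutative) and all modules are unitary left modules. A module $M$ is virtually semisimple if each submodule of $M$ is isomorphic to a direct summand of $M$. It is completely virtually semisimple if each submodule of $M$ is a virtually semisimple module. A ring $R$ is left completely virtually semisimple if the left module ${}_RR$ is completely virtually semisimple. A domain is a nonzero (not necessarily commutative) ring without zero divisors; a principal left ideal domain is a domain in which every left ideal is principal, i.e. of the form $Da$. $M_n(D)$ denotes the ring of $n\times n$ matrices over $D$. *)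

(* Defs.v *)
From HB Require Import structures.
From mathcomp Require Import all_boot all_order all_fingroup all_algebra.
From mathcomp Require Import boolp classical_sets.

Set Implicit Arguments.
Unset Strict Implicit.
Unset Printing Implicit Defensive.

Import GRing.Theory.
Local Open Scope classical_set_scope.
Local Open Scope ring_scope.

(* Submodules are Prop-valued sets ([set M := M -> Prop]), so they are not
   restricted to decidable ones. *)
Record submodule (R : pzRingType) (M : lmodType R) := Submodule {
  submod_set :> set M;
  submod_setP : GRing.submod_closed [pred x | x \in submod_set] }.

(* A separate name, so that the module structure inherited from [M] is attached
   to submodules and not to arbitrary subsets. *)
Definition submod_type (R : pzRingType) (M : lmodType R) (N : submodule M) :
  Type := set_type N.

Section SubmodType.
Variables (R : pzRingType) (M : lmodType R) (N : submodule M).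

HB.instance Definition _ := SubChoice.on (submod_type N).

Lemma submod_subsemimod_closed :
  GRing.subsemimod_closed [pred x | x \in submod_set N].
Proof. exact: GRing.submod_closed_semi (submod_setP N). Qed.

HB.instance Definition _ := GRing.SubChoice_isSubLmodule.Build R M
  [pred x | x \in submod_set N] (submod_type N) submod_subsemimod_closed.
End SubmodType.

Definition lmod_iso (R : pzRingType) (M N : lmodType R) : Prop :=
  exists f : {linear M -> N}, bijective f.

Definition is_direct_summand (R : pzRingType) (M : lmodType R)
    (K : submodule M) : Prop :=
  exists L : submodule M,
    (forall x : M, exists y z : M,
       [/\ y \in submod_set K, z \in submod_set L & x = y + z]) /\
    submod_set K `&` submod_set L = [set 0].

Definition virtually_semisimple (R : pzRingType) (M : lmodType R) : Prop :=
  forall N : submodule M, exists K : submodule M,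
    is_direct_summand K /\ lmod_iso (submod_type N) (submod_type K).

Definition completely_virtually_semisimple (R : pzRingType) (M : lmodType R) :
  Prop := forall N : submodule M, virtually_semisimple (submod_type N).

Definition left_completely_virtually_semisimple (R : pzRingType) : Prop :=
  completely_virtually_semisimple R^o.

(* [idomainType] is commutative, hence the bare axiom on an [nzRingType]. *)
Definition is_domain (D : nzRingType) : Prop := GRing.integral_domain_axiom D.

Definition principal_left_ideal_domain (D : nzRingType) : Prop :=
  is_domain D /\
  forall I : submodule D^o, exists a : D,
    (I : set D) = [set d * a | d in [set: D]].

Definition ring_iso (R S : pzRingType) : Prop :=
  exists f : {rmorphism R -> S}, bijective f.

(* The library's pointwise ring structure on finite functions covers only
   constant families. *)
Definition prod_ring (k : nat) (T : 'I_k -> pzRingType) : Type :=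
  {dffun forall i : 'I_k, T i}.

Section ProdRing.
Variables (k : nat) (T : 'I_k -> pzRingType).
Local Notation P := (prod_ring T).
Implicit Types x y z : P.

HB.instance Definition _ := Choice.on P.

Definition prod_ring_zero : P := [ffun i => 0 : T i].
Definition prod_ring_one : P := [ffun i => 1 : T i].
Definition prod_ring_opp x : P := [ffun i => - x i].
Definition prod_ring_add x y : P := [ffun i => x i + y i].
Definition prod_ring_mul x y : P := [ffun i => x i * y i].

Fact prod_ring_addA : associative prod_ring_add.
Proof. by move=> x y z; apply/ffunP => i; rewrite !ffunE addrA. Qed.
Fact prod_ring_addC : commutative prod_ring_add.
Proof. by move=> x y; apply/ffunP => i; rewrite !ffunE addrC. Qed.
Fact prod_ring_add0 : left_id prod_ring_zero prod_ring_add.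
Proof. by move=> x; apply/ffunP => i; rewrite !ffunE add0r. Qed.
Fact prod_ring_addN : left_inverse prod_ring_zero prod_ring_opp prod_ring_add.
Proof. by move=> x; apply/ffunP => i; rewrite !ffunE addNr. Qed.
Fact prod_ring_mulA : associative prod_ring_mul.
Proof. by move=> x y z; apply/ffunP => i; rewrite !ffunE mulrA. Qed.
Fact prod_ring_mul1l : left_id prod_ring_one prod_ring_mul.
Proof. by move=> x; apply/ffunP => i; rewrite !ffunE mul1r. Qed.
Fact prod_ring_mul1r : right_id prod_ring_one prod_ring_mul.
Proof. by move=> x; apply/ffunP => i; rewrite !ffunE mulr1. Qed.
Fact prod_ring_mulDl : left_distributive prod_ring_mul prod_ring_add.
Proof. by move=> x y z; apply/ffunP => i; rewrite !ffunE mulrDl. Qed.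
Fact prod_ring_mulDr : right_distributive prod_ring_mul prod_ring_add.
Proof. by move=> x y z; apply/ffunP => i; rewrite !ffunE mulrDr. Qed.

HB.instance Definition _ := GRing.isPzRing.Build P
  prod_ring_addA prod_ring_addC prod_ring_add0 prod_ring_addN
  prod_ring_mulA prod_ring_mul1l prod_ring_mul1r
  prod_ring_mulDl prod_ring_mulDr.
End ProdRing.

Definition matrix_prod (k : nat) (n : 'I_k -> nat) (D : 'I_k -> nzRingType) :
  pzRingType := prod_ring (fun i => 'M[D i]_(n i) : pzRingType).

(* Main.v *)
Require Import Defs.
From HB Require Import structures.
From mathcomp Require Import all_boot all_order all_fingroup all_algebra.
From mathcomp Require Import boolp classical_sets.

(** The proof is the Wedderburn-Artin argument, with principal left ideal
    domains in place of division rings and a version of Schur's lemma that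
    survives this change.

    Let R be left completely virtually semisimple.  A left ideal K of Re, with
    e idempotent, is isomorphic to a direct summand Rk of Re, and so K = Rz for
    an element z with kz = z and the same left annihilator as k
    ([cvs_ideal_idem]).  For e = 1 this says that all left ideals are
    principal, hence that R is left noetherian, and 1 is a finite sum of
    orthogonal primitive idempotents ([primitive_decomposition]).  For e
    primitive it says that Re is isomorphic to each of its nonzero submodules.
    So a nonzero map Re -> Rf between primitive idempotents has image
    isomorphic to Rf, which is projective; its kernel is a proper direct
    summand of the indecomposable Re, so it vanishes, and Re and Rf are
    isomorphic ([primitive_schur]).  As over a semisimple ring, there are thus
    no nonzero maps between different isomorphism classes, and grouping the
    primitive idempotents by class gives a system of matrix units that
    identifies R with a product of matrix rings over the corner rings eRe
    ([primitive_frame], [frame_ring_iso]).  The corner eRe is a domain because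
    its nonzero elements act injectively, and its left ideals are principal
    because the submodules of Re are cyclic ([corner_map_pli]).

    Conversely, the left ideals of M_n(D) correspond to the submodules of the
    row module D^n.  When D is a principal left ideal domain and V <= U <= D^n,
    these are free of ranks t <= s, so V is isomorphic to the span of the first
    t vectors of a basis of U, a direct summand of U ([cvs_matrix_prod]).

    For uniqueness, each decomposition of R provides matrix units whose
    diagonal idempotents are primitive, because their corners are domains.  By
    the Schur lemma again, each class of the first system meets exactly one
    class of the second; associated idempotents have isomorphic corners
    ([associated_corner_iso]), and the two systems have the same central
    blocks.  A difference in the sizes of corresponding blocks would produce a
    one-sided inverse, which cannot exist in a left noetherian ring
    ([frame_rank_le]). *)

Set Implicit Arguments.
Unset Strict Implicit.
Unset Printing Implicit Defensive.

Import GRing.Theory.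
Local Open Scope ring_scope.

(** * Virtual semisimplicity in terms of sets and graphs *)

Definition lin_closed (R : pzRingType) (M : lmodType R) (N : M -> Prop) : Prop :=
  N 0 /\ forall a x y, N x -> N y -> N (a *: x + y).

Definition left_ideal (R : pzRingType) (N : R -> Prop) : Prop :=
  @lin_closed R R^o N.

(** An isomorphism between the submodules A of M and B of M', given by its
    graph.  As a relation on the ambient modules it is symmetric in A and B,
    and it needs no values outside A. *)
Record lin_graph (R : pzRingType) (M M' : lmodType R)
    (A : M -> Prop) (B : M' -> Prop) (r : M -> M' -> Prop) : Prop := LinGraph {
  lin_graphP : forall a x x' y y', r x x' -> r y y' ->
                 r (a *: x + y) (a *: x' + y');
  lin_graph_dom : forall x, A x <-> exists y, r x y;
  lin_graph_rng : forall y, B y <-> exists x, r x y;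
  lin_graph_zero : forall x y, r x y -> x = 0 <-> y = 0 }.

(** Left complete virtual semisimplicity, with the nested submodules of
    submodules flattened into left ideals of R. *)
Definition cvs_ideals (R : pzRingType) : Prop :=
  forall N K : R -> Prop, left_ideal N -> left_ideal K ->
    (forall x, K x -> N x) ->
    exists (K' L : R -> Prop) (r : R -> R -> Prop),
      [/\ left_ideal K' /\ left_ideal L,
          forall x, N x <-> exists y z, [/\ K' y, L z & x = y + z],
          forall x, K' x -> L x -> x = 0
        & @lin_graph R R^o R^o K K' r].

Section Submodules.
Variables (R : pzRingType) (M : lmodType R).

Lemma lin_closed_submod (N : submodule M) : lin_closed (submod_set N).
Proof.
have [h0 h] := submod_setP N; split; first by have := h0; rewrite inE.
move=> a x y Nx Ny; have := h a x y; rewrite !inE; exact.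
Qed.

Lemma lin_closed_submodE (N : M -> Prop) : lin_closed N ->
  GRing.submod_closed [pred x | x \in (N : set M)].
Proof.
move=> [h0 h]; split; first by rewrite inE.
by move=> a x y; rewrite !inE; apply: h.
Qed.

Definition submod_of (N : M -> Prop) (hN : lin_closed N) : submodule M :=
  Submodule (lin_closed_submodE hN).

Lemma submod_valP (N : submodule M) (x : submod_type N) :
  submod_set N (val x).
Proof. by have := valP x; rewrite /= inE. Qed.

Lemma submod_lift (N : submodule M) (x : M) : submod_set N x ->
  exists p : submod_type N, val p = x.
Proof.
move=> Nx; have h : x \in [pred x | x \in submod_set N].
  by rewrite inE.
by exists (Sub x h); rewrite SubK.
Qed.

Lemma val_submodP (N : submodule M) a (x y : submod_type N) :
  val (a *: x + y) = a *: val x + val y.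
Proof. exact: (linearP (val : {linear submod_type N -> M})). Qed.

End Submodules.

Section ImagePreimage.
Variables (R : pzRingType) (M : lmodType R).

Lemma lin_closed_image (N : submodule M) (K : submodule (submod_type N)) :
  lin_closed
    (fun x : M => exists2 p : submod_type N, submod_set K p & val p = x).
Proof.
have [h0 h] := lin_closed_submod K; split; first by exists 0; rewrite ?raddf0.
move=> a x y [p Kp <-] [q Kq <-]; exists (a *: p + q); first exact: h.
exact: val_submodP.
Qed.

Lemma lin_closed_preim (N : submodule M) (K : M -> Prop) : lin_closed K ->
  lin_closed (fun p : submod_type N => K (val p)).
Proof.
move=> [h0 h]; split; first by rewrite raddf0.
by move=> a x y Kx Ky; rewrite val_submodP; apply: h.
Qed.
End ImagePreimage.

Section Isomorphisms.
Variables (R : pzRingType) (M M' : lmodType R).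
Variables (r : M -> M' -> Prop).
Hypothesis r_lin : lin_graph (fun=> True) (fun=> True) r.

Lemma lin_graph_iso : lmod_iso M M'.
Proof.
have [rP rd rr r0] := r_lin.
have rB x x' y y' : r x x' -> r y y' -> r (x - y) (x' - y').
  move=> h1 h2; have := rP (-1) _ _ _ _ h2 h1.
  by rewrite !scaleN1r !(addrC (- _)).
have [f fP] : {f & forall x, r x (f x)} by apply: choice => x; apply/rd.
have [g gP] : {g & forall y, r (g y) y}.
  by apply: (@choice _ _ (fun y x => r x y)) => y; apply/rr.
have rI x y y' : r x y -> r x y' -> y = y'.
  move=> h1 h2; apply/subr0_eq; apply/(r0 _ _ (rB _ _ _ _ h1 h2)).
  by rewrite subrr.
have rJ x x' y : r x y -> r x' y -> x = x'.
  move=> h1 h2; apply/subr0_eq; apply/(r0 _ _ (rB _ _ _ _ h1 h2)).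
  by rewrite subrr.
have f_lin : linear f by move=> a x y; apply: rI (fP _) (rP _ _ _ _ _ _ _).
pose flin := GRing.isLinear.Build R M M' *:%R f f_lin.
pose F : {linear M -> M'} := HB.pack f flin.
exists F; exists g => x; first exact: rJ (gP _) (fP _).
exact: rI (fP _) (gP _).
Qed.
End Isomorphisms.

Section Nested.
Variables (R : pzRingType) (M : lmodType R).

(** Submodules of the submodule N and subsets of N closed under linear
    combinations determine each other through the inclusion of N into M, and so
    do isomorphisms and their graphs. *)
Lemma cvs_subP : completely_virtually_semisimple M <->
  forall N K : M -> Prop, lin_closed N -> lin_closed K ->
    (forall x, K x -> N x) ->
    exists (K' L : M -> Prop) (r : M -> M -> Prop),
      [/\ lin_closed K' /\ lin_closed L,
          forall x, N x <-> exists y z, [/\ K' y, L z & x = y + z],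
          forall x, K' x -> L x -> x = 0
        & @lin_graph R M M K K' r].
Proof.
split=> [h N K hN hK KN|h N K].
  pose N1 := submod_of hN.
  pose K1 := submod_of (@lin_closed_preim _ _ N1 _ hK).
  have [K2 [[L2 [dec int]] [f [g fK gK]]]] := h N1 K1.
  exists (fun x => exists2 p : submod_type N1, submod_set K2 p & val p = x).
  exists (fun x => exists2 p : submod_type N1, submod_set L2 p & val p = x).
  exists (fun x y => exists2 p : submod_type K1,
            val (val p) = x & val (val (f p)) = y).
  split.
  - by split; apply: lin_closed_image.
  - move=> x; split=> [Nx|[y [z [[p Kp <-] [q Lq <-] ->]]]].
      have [p <-] := @submod_lift _ _ N1 _ Nx.
      have [y [z [/set_mem Ky /set_mem Lz ->]]] := dec p.
      by exists (val y), (val z); split; [exists y|exists z|rewrite raddfD].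
    by rewrite -raddfD; apply: (@submod_valP _ _ N1).
  - move=> x [p Kp <-] [q Lq /val_inj E]; rewrite E in Lq.
    suff : ([set 0] : set (submod_type N1))%classic p.
      by move=> ->; rewrite raddf0.
    by rewrite -int.
  - split.
    + move=> a x x' y y' [p <- <-] [q <- <-]; exists (a *: p + q).
        by rewrite !val_submodP.
      by rewrite linearP !val_submodP.
    + move=> x; split=> [Kx|[y [p <- _]]]; last exact: (@submod_valP _ _ K1).
      have [p1 p1E] := @submod_lift _ _ N1 _ (KN _ Kx).
      have [|p pE] := @submod_lift _ _ K1 p1; first by rewrite /= p1E.
      by exists (val (val (f p))), p; rewrite ?pE ?p1E.
    + move=> y; split=> [[q Kq <-]|[x [p _ <-]]]; last first.
        by exists (val (f p)) => //; apply: submod_valP.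
      have [p pE] := @submod_lift _ _ K2 _ Kq.
      by exists (val (val (g p))), (g p); rewrite ?gK ?pE.
    + move=> x y [p <- <-]; split=> E.
        have -> : p = 0.
          by do 2 apply: val_inj; rewrite E !raddf0.
        by rewrite !raddf0.
      have fp0 : f p = 0 by do 2 apply: val_inj; rewrite E !raddf0.
      by rewrite -[p]fK fp0 -[0](linear0 f) fK !raddf0.
have hN := lin_closed_submod N.
have hK := @lin_closed_image _ _ N K.
have [|K' [L [r [[hK' hL] dec int rP]]]] := h _ _ hN hK.
  by move=> x [p _ <-]; apply: submod_valP.
have K'N x : K' x -> submod_set N x.
  by move=> K'x; apply/dec; exists x, 0; rewrite addr0; split => //; case: hL.
have LN x : L x -> submod_set N x.
  by move=> Lx; apply/dec; exists 0, x; rewrite add0r; split => //; case: hK'.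
exists (submod_of (@lin_closed_preim _ _ N _ hK')); split.
  exists (submod_of (@lin_closed_preim _ _ N _ hL)); split.
    move=> x; have /dec[y [z [Ky Lz E]]] := submod_valP x.
    have [p pE] := submod_lift (K'N _ Ky).
    have [q qE] := submod_lift (LN _ Lz).
    exists p, q; split; first by apply/mem_set; change (K' (val p)); rewrite pE.
      by apply/mem_set; change (L (val q)); rewrite qE.
    by apply: val_inj; rewrite -(scale1r p) val_submodP scale1r pE qE.
  apply/seteqP; split=> x /=.
    by move=> [K'x Lx]; apply: val_inj; rewrite raddf0; apply: int.
  have v0 : val (0 : submod_type N) = 0 by exact: raddf0.
  by move=> ->; split; [case: hK'|case: hL]; rewrite -v0.
have [rL rd rr r0] := rP.
apply: (@lin_graph_iso _ _ _ (fun p q => r (val (val p)) (val (val q)))).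
split.
- by move=> a x x' y y'; rewrite !val_submodP; apply: rL.
- move=> p; split=> // _.
  have [|y ry] := (rd (val (val p))).1.
    by exists (val p) => //; apply: submod_valP.
  have K'y : K' y by apply/rr; exists (val (val p)).
  have [q qE] := submod_lift (K'N _ K'y).
  have [|q' q'E] :=
      @submod_lift _ _ (submod_of (@lin_closed_preim _ _ N _ hK')) q.
    by rewrite /= qE.
  by exists q'; rewrite q'E qE.
- move=> q; split=> // _.
  have K'q := submod_valP q.
  have [x rx] := (rr _).1 K'q.
  have /rd[p Kp pE] : exists y, r x y by exists (val (val q)).
  have [p' p'E] := submod_lift Kp.
  by exists p'; rewrite p'E pE.
- move=> p q /r0[h1 h2]; split=> E.
    by do 2 apply: val_inj; rewrite !raddf0; apply: h1; rewrite E !raddf0.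
  by do 2 apply: val_inj; rewrite !raddf0; apply: h2; rewrite E !raddf0.
Qed.
End Nested.

Lemma cvs_idealsP (R : nzRingType) :
  left_completely_virtually_semisimple R <-> cvs_ideals R.
Proof. exact: (@cvs_subP R R^o). Qed.

(** * Submodules of free modules over a principal left ideal domain *)

Definition principal_left_ideals (R : pzRingType) : Prop :=
  forall I : R -> Prop, left_ideal I ->
    exists a, forall x, I x <-> exists d, x = d * a.

Lemma pli_principal (D : nzRingType) :
  principal_left_ideal_domain D -> principal_left_ideals D.
Proof.
move=> [_ h] I hI; have [a Ia] := h (submod_of (hI : @lin_closed D D^o I)).
exists a => x; split=> [Ix|[d ->]].
  have : ([set d * a | d in [set: D]])%classic x by rewrite -Ia.
  by case=> d _ <-; exists d.
change ((submod_of (hI : @lin_closed D D^o I) : set D) (d * a)).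
by rewrite Ia; exists d.
Qed.

Section RowSpace.
Variable D : nzRingType.
Hypothesis D_dom : is_domain D.
Hypothesis D_pli : principal_left_ideals D.

Definition row_basis (m s : nat) (B : 'M[D]_(m, s)) (V : 'rV[D]_s -> Prop) :=
  (forall w, V w <-> exists c : 'rV_m, w = c *m B) /\
  (forall c : 'rV_m, c *m B = 0 -> c = 0).

(** The first coordinates of the vectors of V form a left ideal Da.  If a = 0,
    then V lies in the submodule of vectors with first coordinate 0.  Otherwise
    a vector w of V with first coordinate a extends every basis of the
    intersection of V with that submodule to a basis of V: the multiples of w
    realize all first coordinates, and da = 0 only for d = 0. *)
Lemma submodule_row_basis s (V : 'rV[D]_s -> Prop) : lin_closed V ->
  exists2 t : nat, (t <= s)%N & exists B : 'M[D]_(t, s), row_basis B V.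
Proof.
elim: s V => [|s IHs].
  move=> V [V0 _]; exists 0%N => //; exists 0; split=> [w|c _].
    by rewrite (thinmx0 w); split=> // _; exists 0; rewrite thinmx0.
  exact: thinmx0.
rewrite -[s.+1]add1n => V [V0 VP].
have lE (w : 'rV[D]_(1 + s)) : lsubmx w = (w 0 (lshift s 0))%:M.
  by rewrite [LHS]mx11_scalar mxE.
pose I := fun a : D => exists2 w : 'rV_(1 + s), V w & lsubmx w = a%:M.
have Iid : left_ideal I.
  split; first by exists 0; rewrite // linear0 raddf0.
  move=> a x y [w Vw wE] [w' Vw' w'E]; exists (a *: w + w'); first exact: VP.
  by rewrite linearP /= wE w'E raddfD /= -scale_scalar_mx.
pose V' := fun w : 'rV_s => V (row_mx 0 w).
have V'_lin : lin_closed V'.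
  split; first by rewrite /V' row_mx0.
  move=> a x y Vx Vy; rewrite /V'.
  have -> : row_mx 0 (a *: x + y) = a *: row_mx 0 x + row_mx 0 y :> 'rV_(1 + s).
    by rewrite scale_row_mx add_row_mx scaler0 addr0.
  exact: VP.
have [t let' [B' [B'E B'free]]] := IHs _ V'_lin.
have [a aE] := D_pli Iid.
have [a0|a_neq0] := eqVneq a 0.
  exists t; first exact: leqW.
  exists (row_mx 0 B'); split=> [w|c]; last first.
    rewrite mul_mx_row => /(congr1 rsubmx); rewrite row_mxKr linear0.
    exact: B'free.
  split=> [Vw|[c ->]]; last by rewrite mul_mx_row mulmx0; apply/B'E; exists c.
  have w0 : lsubmx w = 0.
    have [|d] := (aE (w 0 (lshift s 0))).1.
      by exists w.
    by rewrite a0 mulr0 lE => ->; rewrite raddf0.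
  have [|c cE] := (B'E (rsubmx w)).1.
    by rewrite /V' -w0 hsubmxK.
  by exists c; rewrite mul_mx_row mulmx0 -cE -w0 hsubmxK.
have /aE[w Vw wE] : exists d, a = d * a by exists 1; rewrite mul1r.
exists (1 + t)%N; first by rewrite leq_add2l.
exists (col_mx w (row_mx 0 B')); split=> [x|c]; last first.
  rewrite -[c]hsubmxK mul_row_col -[w]hsubmxK wE !mul_mx_row mulmx0.
  rewrite add_row_mx addr0 => E.
  have c0 : lsubmx c = 0.
    move: (congr1 lsubmx E); rewrite row_mxKl linear0 [lsubmx c]mx11_scalar.
    rewrite -scalar_mxM => /(congr1 (fun A : 'M_1 => A 0 0)).
    rewrite !mxE eqxx !mulr1n.
    case/D_dom/orP=> [/eqP ->|/idPn[//]]; first exact: raddf0.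
  move: (congr1 rsubmx E); rewrite row_mxKr linear0 c0 mul0mx add0r.
  by move/B'free ->; rewrite row_mx0.
split=> [Vx|[c ->]]; last first.
  rewrite -[c]hsubmxK mul_row_col mul_mx_row mulmx0.
  rewrite [lsubmx c]mx11_scalar mul_scalar_mx; apply: VP => //.
  by apply/B'E; exists (rsubmx c).
have [|d dE] := (aE (x 0 (lshift s 0))).1.
  by exists x.
have y0 : lsubmx (x - d *: w) = 0.
  rewrite linearB /= linearZ_LR /= wE scale_scalar_mx -dE.
  by rewrite lE subrr.
have [|c cE] := (B'E (rsubmx (x - d *: w))).1.
  by rewrite /V' -y0 hsubmxK addrC -scaleNr; apply: VP.
exists (row_mx d%:M c); rewrite mul_row_col mul_mx_row mulmx0 -cE -y0 hsubmxK.
by rewrite mul_scalar_mx addrC subrK.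
Qed.
(** A basis of U identifies U with D^s, where V becomes a submodule of a free
    module of rank s. *)
Lemma nested_row_bases n (U V : 'rV[D]_n -> Prop) :
    lin_closed U -> lin_closed V -> (forall w, V w -> U w) ->
  exists s t (B : 'M_(s, n)) (C : 'M_(t, n)),
    [/\ (t <= s)%N, row_basis B U & row_basis C V].
Proof.
move=> hU [V0 VP] VU; have [s _ [B [BU Bfree]]] := submodule_row_basis hU.
have hW : lin_closed (fun c : 'rV_s => V (c *m B)).
  split=> [|a x y Vx Vy]; first by rewrite mul0mx.
  by rewrite mulmxDl -scalemxAl; apply: VP.
have [t let' [G [GW Gfree]]] := submodule_row_basis hW.
exists s, t, B, (G *m B); split=> //; split=> [w|c]; last first.
  by rewrite mulmxA => /Bfree/Gfree.
split=> [Vw|[c ->]]; last by rewrite mulmxA; apply/GW; exists c.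
have /BU[c cE] := VU _ Vw; rewrite cE in Vw.
by have /GW[d dE] := Vw; exists d; rewrite mulmxA -dE.
Qed.

Lemma row_basis_mx m s n (B : 'M[D]_(s, n)) V (X : 'M_(m, n)) : row_basis B V ->
  (forall a, V (row a X)) <-> exists C, X = C *m B.
Proof.
move=> [BV _]; split=> [VX|[C ->] a]; last first.
  by apply/BV; exists (row a C); rewrite row_mul.
have [c cE] : {c : 'I_m -> 'rV_s & forall a, row a X = c a *m B}.
  by apply: (@choice _ _ (fun a c => row a X = c *m B)) => a; apply/BV.
exists (\matrix_a c a); apply/row_matrixP => a.
by rewrite row_mul rowK.
Qed.

Lemma row_basis_inj m s n (B : 'M[D]_(s, n)) V (C : 'M_(m, s)) : row_basis B V ->
  C *m B = 0 -> C = 0.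
Proof.
move=> [_ Bfree] CB0; apply/row_matrixP => a; rewrite row0; apply: Bfree.
by rewrite -row_mul CB0 row0.
Qed.

End RowSpace.

(** * Products of matrix rings over principal left ideal domains *)

Section ProdBlocks.
Variables (k : nat) (n : 'I_k -> nat) (D : 'I_k -> nzRingType).
Local Notation S := (matrix_prod n D).
Implicit Types (x y : S) (i j : 'I_k).

Lemma matrix_prodP x y : (forall i, x i = y i) -> x = y.
Proof. by move=> E; apply/ffunP. Qed.

Lemma matrix_prod0 i : (0 : S) i = 0.
Proof. by rewrite ffunE. Qed.

Lemma matrix_prod1 i : (1 : S) i = 1%:M.
Proof. by rewrite ffunE. Qed.

Lemma matrix_prodD x y i : (x + y) i = x i + y i.
Proof. by rewrite ffunE. Qed.

Lemma matrix_prodN x i : (- x) i = - x i.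
Proof. by rewrite ffunE. Qed.

Lemma matrix_prodM x y i : (x * y) i = x i *m y i.
Proof. by rewrite ffunE. Qed.

Lemma matrix_prod_sum (I : Type) (r : seq I) (P : pred I) (F : I -> S) i :
  (\sum_(a <- r | P a) F a) i = \sum_(a <- r | P a) F a i.
Proof.
by elim/big_ind2: _ => [|? ? ? ? <- <-|//]; rewrite ?matrix_prod0 ?matrix_prodD.
Qed.

Definition block i (A : 'M[D i]_(n i)) : S :=
  finfun (dfwith (fun j => 0 : 'M[D j]_(n j)) A).

Lemma block_in i (A : 'M[D i]_(n i)) : block A i = A.
Proof. by rewrite ffunE dfwith_in. Qed.

Lemma block_out i j (A : 'M[D i]_(n i)) : i != j -> block A j = 0.
Proof. by move=> ij; rewrite ffunE dfwith_out. Qed.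

Lemma block_eq i (A : 'M[D i]_(n i)) x :
  A = x i -> (forall j, i != j -> x j = 0) -> block A = x.
Proof.
move=> Ai xj; apply: matrix_prodP => j; have [<-|ij] := eqVneq i j.
  by rewrite block_in.
by rewrite block_out // xj.
Qed.

Lemma block_is_additive i : {morph @block i : A B / A + B}.
Proof.
move=> A B; apply: block_eq => [|j ij]; first by rewrite matrix_prodD !block_in.
by rewrite matrix_prodD !block_out // addr0.
Qed.

Lemma block0 i : @block i 0 = 0.
Proof. by apply: block_eq => *; rewrite matrix_prod0. Qed.

Lemma block_sum i (I : Type) (r : seq I) (P : pred I) (F : I -> 'M[D i]_(n i)) :
  block (\sum_(a <- r | P a) F a) = \sum_(a <- r | P a) block (F a).
Proof. by rewrite (big_morph _ (@block_is_additive i) (block0 i)). Qed.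

Lemma mul_block i (A : 'M[D i]_(n i)) x : block A * x = block (A *m x i).
Proof.
apply/esym/block_eq => [|j ij]; first by rewrite matrix_prodM block_in.
by rewrite matrix_prodM block_out // mul0mx.
Qed.

Lemma sum_blocks x : x = \sum_i block (x i).
Proof.
apply: matrix_prodP => i; rewrite matrix_prod_sum (bigD1 i) //= block_in.
by rewrite big1 ?addr0 // => j ji; rewrite block_out.
Qed.
End ProdBlocks.

Section ProdIdeals.
Variables (k : nat) (n : 'I_k -> nat) (D : 'I_k -> nzRingType).
Hypothesis D_dom : forall i, is_domain (D i).
Hypothesis D_pli : forall i, principal_left_ideals (D i).
Local Notation S := (matrix_prod n D).

(** The Morita correspondence: the D_i-module of the rows of the i-th
    components of the elements of N. *)
Definition ideal_rows (N : S -> Prop) i (w : 'rV[D i]_(n i)) : Prop :=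
  forall c : 'cV[D i]_(n i), N (block (c *m w)).

Lemma ideal_rows_lin (N : S -> Prop) i :
  left_ideal N -> lin_closed (@ideal_rows N i).
Proof.
move=> [N0 NP]; split=> [c|a x y Nx Ny c]; first by rewrite mulmx0 block0.
rewrite mulmxDr -mul_scalar_mx mulmxA block_is_additive.
have -> : block (c *m a%:M *m x) = (1 : S) * block (c *m a%:M *m x).
  by rewrite mul1r.
exact: NP.
Qed.

(** A matrix is a sum of products of a column and one of its rows; conversely,
    a column times a row of a component of x is a left multiple of x. *)
Lemma ideal_rowsP (N : S -> Prop) x : left_ideal N ->
  N x <-> forall i a, ideal_rows N (row a (x i)).
Proof.
move=> [N0 NP]; split=> [Nx i a c|Nx].
  have -> : block (c *m row a (x i)) = block (c *m delta_mx 0 a) * x + 0.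
    by rewrite addr0 mul_block -mulmxA -rowE.
  exact: NP.
have ND y z : N y -> N z -> N (y + z).
  by move=> Ny Nz; have := NP 1 _ _ Ny Nz; rewrite scale1r.
rewrite [x]sum_blocks; elim/big_ind: _ => // i _.
have -> : x i = \sum_a delta_mx a (0 : 'I_1) *m row a (x i).
  rewrite -[x i in LHS]mul1mx mx1_sum_delta mulmx_suml; apply: eq_bigr => a _.
  by rewrite rowE mulmxA mul_delta_mx.
rewrite block_sum; elim/big_ind: _ => // a _; exact: Nx.
Qed.


(** If the rows of N and K have bases B i and C i with s i and t i elements,
    then N and K consist of the families A_i B_i and A_i C_i, with free
    coefficients A_i.  As t i <= s i, the first t i rows of B i span a module
    isomorphic to the rows of K, and the remaining ones a complement of it. *)
Lemma cvs_matrix_prod : cvs_ideals S.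
Proof.
move=> N K hN hK KN.
have bases i := nested_row_bases (@D_dom i) (@D_pli i)
  (ideal_rows_lin i hN) (ideal_rows_lin i hK) (fun w Kw c => KN _ (Kw c)).
have /all_tag[s /= {}bases] i := cid (bases i).
have /all_tag[t /= {}bases] i := cid (bases i).
have /all_tag[B /= {}bases] i := cid (bases i).
have /all_tag[C /= {}bases] i := cid (bases i).
have ts i : (t i <= s i)%N by case: (bases i).
have Bb i : row_basis (B i) (@ideal_rows N i) by case: (bases i).
have Cb i : row_basis (C i) (@ideal_rows K i) by case: (bases i).
pose F m (X : forall i, 'M[D i]_(m i, n i)) (x : S) :=
  forall i, exists A : 'M_(n i, m i), x i = A *m X i.
have F_ideal m X : left_ideal (@F m X).
  split=> [i|a x y Fx Fy i]; first by exists 0; rewrite matrix_prod0 mul0mx.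
  have [A AE] := Fx i; have [A' A'E] := Fy i; exists (a i *m A + A').
  by rewrite matrix_prodD matrix_prodM AE A'E mulmxDl mulmxA.
have NE x : N x <-> F _ B x.
  rewrite (ideal_rowsP _ hN); split=> h i; first exact/(row_basis_mx _ (Bb i)).
  exact: (row_basis_mx _ (Bb i)).2 (h i).
have KE x : K x <-> F _ C x.
  rewrite (ideal_rowsP _ hK); split=> h i; first exact/(row_basis_mx _ (Cb i)).
  exact: (row_basis_mx _ (Cb i)).2 (h i).
pose B1 i : 'M[D i]_(t i, n i) := pid_mx (t i) *m B i.
pose B2 i : 'M[D i]_(s i, n i) := copid_mx (t i) *m B i.
pose r (x y : S) := forall i, exists A, x i = A *m C i /\ y i = A *m B1 i.
have B1_inj i (A : 'M_(n i, t i)) : A *m B1 i = 0 -> A = 0.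
  rewrite mulmxA => /(row_basis_inj (Bb i)) A0.
  rewrite -[A]mulmx1 -(pid_mx_1 _ (t i)) -(@pid_mx_id _ _ (s i)) ?ts //.
  by rewrite mulmxA A0 mul0mx.
exists (F _ B1), (F _ B2), r; split=> [|x|x K'x Lx|].
- by split; apply: F_ideal.
- rewrite NE; split=> [Fx|[y [z [Fy Fz ->]]] i].
    have /all_tag[A AE] i := cid (Fx i).
    exists (finfun (fun i => A i *m pid_mx (t i) *m B1 i)).
    exists (finfun (fun i => A i *m B2 i)).
    split=> [i|i|]; [by rewrite ffunE; eexists|by rewrite ffunE; eexists|].
    apply: matrix_prodP => i; rewrite matrix_prodD !ffunE AE /B1 /B2 !mulmxA.
    rewrite -mulmxDl -(mulmxA (A i)) pid_mx_id ?ts // -mulmxDr.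
    by rewrite addrC subrK mulmx1.
  have [A AE] := Fy i; have [A' A'E] := Fz i.
  exists (A *m pid_mx (t i) + A' *m copid_mx (t i)).
  by rewrite matrix_prodD AE A'E mulmxDl !mulmxA.
- apply: matrix_prodP => i; rewrite matrix_prod0.
  have [A AE] := K'x i; have [A' A'E] := Lx i.
  suff -> : x i = 0 by [].
  have : (A *m pid_mx (t i) - A' *m copid_mx (t i)) *m B i = 0.
    by rewrite mulmxBl -!mulmxA -AE -A'E subrr.
  move/(row_basis_inj (Bb i))/eqP; rewrite subr_eq0 => /eqP.
  move/(congr1 (fun Y => Y *m (pid_mx (t i) : 'M_(s i, t i)))).
  rewrite -!mulmxA mul_copid_mx_pid ?ts // pid_mx_id ?ts // pid_mx_1 mulmx0.
  by rewrite mulmx1 AE => ->; rewrite mul0mx.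
- split=> [a x x' y y' rx ry i|x|y|x y rxy].
  + have [A [xE yE]] := rx i; have [A' [xE' yE']] := ry i.
    exists (a i *m A + A').
    by rewrite !matrix_prodD !matrix_prodM xE yE xE' yE' !mulmxDl !mulmxA.
  + rewrite KE; split=> [Fx|[y rxy] i]; last first.
      by have [A []] := rxy i; exists A.
    have /all_tag[A AE] i := cid (Fx i).
    by exists (finfun (fun i => A i *m B1 i)) => i; exists (A i); rewrite ffunE.
  + split=> [Fy|[x rxy] i]; last by have [A []] := rxy i; exists A.
    have /all_tag[A AE] i := cid (Fy i).
    by exists (finfun (fun i => A i *m C i)) => i; exists (A i); rewrite ffunE.
  + split=> E; apply: matrix_prodP => i; have [A [xE yE]] := rxy i.
      move: xE; rewrite E !matrix_prod0 => /esym/(row_basis_inj (Cb i)) A0.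
      by rewrite yE A0 mul0mx.
    move: yE; rewrite E !matrix_prod0 => /esym/B1_inj A0.
    by rewrite xE A0 mul0mx.
Qed.
End ProdIdeals.

(** * Transport along ring isomorphisms *)

Section RingIso.
Implicit Types R S T : pzRingType.

Lemma ring_iso_sym R S : ring_iso R S -> ring_iso S R.
Proof.
move=> [f [g fK gK]].
pose gadd := GRing.isZmodMorphism.Build S R g (can2_zmod_morphism fK gK).
pose gmul := GRing.isMonoidMorphism.Build S R g (can2_monoid_morphism fK gK).
pose G : {rmorphism S -> R} := HB.pack g gadd gmul.
by exists G; exists f.
Qed.

Lemma left_ideal_preim R S (f : {rmorphism R -> S}) (N : S -> Prop) :
  left_ideal N -> left_ideal (fun x => N (f x)).
Proof.
move=> [N0 NP]; split; first by rewrite rmorph0.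
by move=> a x y Nx Ny; rewrite rmorphD (rmorphM f a x); apply: NP.
Qed.

Lemma cvs_ideals_iso R S : ring_iso R S -> cvs_ideals S -> cvs_ideals R.
Proof.
move=> RS hS N K hN hK KN; have [g [f gK fK]] := ring_iso_sym RS.
have {gK fK} [f' gK fK] :
    exists2 f' : {rmorphism R -> S}, cancel g f' & cancel f' g.
  pose fadd := GRing.isZmodMorphism.Build R S f (can2_zmod_morphism gK fK).
  pose fmul := GRing.isMonoidMorphism.Build R S f (can2_monoid_morphism gK fK).
  by exists (HB.pack f fadd fmul : {rmorphism R -> S}).
have [|K' [L [r [[hK' hL] dec int [rP rd rr r0]]]]] :=
    hS _ _ (left_ideal_preim g hN) (left_ideal_preim g hK).
  by move=> x; apply: KN.
exists (fun x => K' (f' x)), (fun x => L (f' x)), (fun x y => r (f' x) (f' y)).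
split=> [|x|x K'x Lx|].
- by split; apply: left_ideal_preim.
- rewrite -[x in N x]fK; split=> [/dec[y [z [K'y Lz E]]]|[y [z [K'y Lz E]]]].
    by exists (g y), (g z); rewrite !gK -rmorphD -E fK.
  by apply/dec; exists (f' y), (f' z); rewrite E rmorphD.
- by rewrite -[x]fK (int _ K'x Lx) rmorph0.
- split=> [a x x' y y' rx ry|x|y|x y /r0[h1 h2]].
  + by rewrite !rmorphD (rmorphM f' a x) (rmorphM f' a x'); apply: rP.
  + rewrite -{1}[x]fK rd; split=> [[y rxy]|[y rxy]]; last by exists (f' y).
    by exists (g y); rewrite gK.
  + rewrite rr; split=> [[x rxy]|[x rxy]]; last by exists (f' x).
    by exists (g x); rewrite gK.
  + split=> E; first by rewrite -[y]fK h1 ?rmorph0 // E rmorph0.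
    by rewrite -[x]fK h2 ?rmorph0 // E rmorph0.
Qed.
End RingIso.

(** * Primitive idempotents and Schur's lemma *)

Section Idempotents.
Variable R : pzRingType.
Implicit Types e f x y : R.

Definition primitive e : Prop :=
  [/\ e * e = e, e != 0 &
      forall f, f * f = f -> e * f = f -> f * e = f -> f = 0 \/ f = e].

Lemma left_ideal_mul x : left_ideal (fun y : R => exists a, y = a * x).
Proof.
split=> [|a y z [b ->] [c ->]]; first by exists 0; rewrite mul0r.
by exists (a * b + c); rewrite mulrDl -mulrA.
Qed.

(** For idempotents e and f, right multiplication by u and v are mutually
    inverse isomorphisms between the left modules Re and Rf. *)
Definition associated e f : Prop := exists u v : R,
  [/\ e * u = u /\ u * f = u, f * v = v /\ v * e = v, u * v = e & v * u = f].

Lemma associated_sym e f : associated e f -> associated f e.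
Proof. by move=> [u [v [eu fv uv vu]]]; exists v, u. Qed.

Lemma associated_trans e f g : associated e f -> associated f g ->
  associated e g.
Proof.
move=> [u [v [[eu uf] [fv ve] uv vu]]] [u' [v' [[fu' u'g] [gv' v'f] uv' vu']]].
exists (u * u'), (v' * v); split.
- by rewrite mulrA eu -mulrA u'g.
- by rewrite mulrA gv' -mulrA ve.
- by rewrite mulrA -(mulrA u) uv' uf.
- by rewrite mulrA -(mulrA v') vu v'f.
Qed.

Lemma associated_refl e : e * e = e -> associated e e.
Proof. by move=> ee; exists e, e; rewrite !ee. Qed.

Hypothesis R_cvs : cvs_ideals R.

(** The left ideal K is isomorphic to a direct summand of Re, and a direct
    summand is generated by an idempotent k, the component of e in it; z is the
    element that corresponds to k in K. *)
Lemma cvs_ideal_idem e (K : R -> Prop) : e * e = e -> left_ideal K ->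
    (forall x, K x -> x * e = x) ->
  exists k z, [/\ k * k = k /\ e * k = k, k * e = k, k * z = z,
    forall x, K x <-> exists a, x = a * z & forall a, a * z = 0 -> a * k = 0].
Proof.
move=> ee hK Ke; pose N x := exists a : R, x = a * e.
have [|K' [L [r [[hK' hL] dec int [rP rd rr r0]]]]] :=
    R_cvs (left_ideal_mul e) hK.
  by move=> x /Ke <-; exists x.
have K'e x : K' x -> x * e = x.
  move=> K'x; have /dec[a ->] : exists y z, [/\ K' y, L z & x = y + z].
    by exists x, 0; rewrite addr0; split=> //; case: hL.
  by rewrite -mulrA ee.
have K'M a x : K' x -> K' (a * x).
  by move=> K'x; have := hK'.2 a x 0 K'x hK'.1; rewrite addr0.
have LM a x : L x -> L (a * x).
  by move=> Lx; have := hL.2 a x 0 Lx hL.1; rewrite addr0.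
have K'B x y : K' x -> K' y -> K' (x - y).
  by move=> K'x K'y; have := hK'.2 (-1) y x K'y K'x; rewrite scaleN1r addrC.
have LB x y : L x -> L y -> L (x - y).
  by move=> Lx Ly; have := hL.2 (-1) y x Ly Lx; rewrite scaleN1r addrC.
have rM a x y : r x y -> r (a * x) (a * y).
  have r00 : r 0 0.
    have [z rz] := (rd 0).1 hK.1; have z0 := (r0 _ _ rz).1 erefl.
    by rewrite z0 in rz.
  by move=> rxy; have := rP a _ _ _ _ rxy r00; rewrite !addr0.
have rB x y x' y' : r x y -> r x' y' -> r (x - x') (y - y').
  move=> h1 h2; have := rP (-1) _ _ _ _ h2 h1.
  by rewrite !scaleN1r !(addrC (- _)).
have [k [l [K'k Ll eE]]] : exists k l, [/\ K' k, L l & e = k + l].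
  by apply/dec; exists 1; rewrite mul1r.
have ke := K'e _ K'k.
have K'k_id x : K' x -> x * k = x.
  move=> K'x; apply/esym/subr0_eq.
  have E : x - x * k = x * l.
    by rewrite -{1}(K'e _ K'x) eE mulrDr addrC addKr.
  by apply: int; [apply/K'B/K'M|rewrite E; apply: LM].
have kk := K'k_id _ K'k.
have ek : e * k = k.
  apply/subr0_eq; have E : e * k - k = l - e * l.
    apply/eqP; rewrite subr_eq addrAC eq_sym subr_eq addrC -eE -mulrDr -eE ee.
    by [].
  apply: int; first by apply/K'B => //; apply: K'M.
  by rewrite E; apply/LB => //; apply: LM.
have [z rzk] := (rr _).1 K'k.
exists k, z; split=> //; last 2 first.
- move=> x; split=> [Kx|[a ->]]; last by apply/rd; exists (a * k); apply: rM.
  have [y rxy] := (rd _).1 Kx; exists y.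
  have /K'k_id yk : K' y by apply/rr; exists x.
  have /r0[_ h] := rB _ _ _ _ rxy (rM y _ _ rzk).
  by apply/subr0_eq/h; rewrite yk subrr.
- by move=> a az0; apply/(r0 (a * z)) => //; apply: rM.
have /r0[_ h] := rB _ _ _ _ (rM k _ _ rzk) rzk.
by apply/subr0_eq/h; rewrite kk subrr.
Qed.

Lemma cvs_principal : principal_left_ideals R.
Proof.
move=> I hI; have [|k [z [_ _ _ Iz _]]] := cvs_ideal_idem (mulr1 1) hI.
  by move=> x _; rewrite mulr1.
by exists z.
Qed.

(** Since a primitive idempotent e leaves only 0 and e for the idempotent k of
    [cvs_ideal_idem], Re is isomorphic to each of its nonzero submodules. *)
Lemma primitive_ideal e (K : R -> Prop) : primitive e -> left_ideal K ->
    (forall x, K x -> x * e = x) -> (exists2 x, K x & x != 0) ->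
  exists z, [/\ e * z = z, z * e = z, forall x, K x <-> exists a, x = a * z
              & forall a, a * z = 0 -> a * e = 0].
Proof.
move=> [ee e0 e_prim] hK Ke [x Kx x0].
have [k [z [[kk ek] ke kz Kz z_free]]] := cvs_ideal_idem ee hK Ke.
have ze : z * e = z by apply/Ke/Kz; exists 1; rewrite mul1r.
have [kE|kE] := e_prim _ kk ek ke; last first.
  by exists z; rewrite -kE; split => //; rewrite kE.
have [a xE] := (Kz x).1 Kx; move: x0.
by rewrite xE -kz kE mul0r mulr0 eqxx.
Qed.

(** Right multiplication by the nonzero element y of eRf maps Re onto Ry, which
    is isomorphic to Rf and generated by an element z with the left annihilator
    of f.  If y = uz and z = vy, then vu = f, so that uv is an idempotent of
    eRe other than 0, hence equal to e.  The second conclusion says that Re ->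
    Rf is injective. *)
Lemma primitive_schur e f x : primitive e -> primitive f ->
  e * x * f != 0 ->
  associated e f /\ forall a, a * (e * x * f) = 0 -> a * e = 0.
Proof.
move=> [ee e0 e_prim] f_prim; set y := e * x * f => y0.
have [ff f0 _] := f_prim.
have ey : e * y = y by rewrite /y !mulrA ee.
have yf : y * f = y by rewrite /y -!mulrA ff.
have [w [z [fz zf [yE [b zE]] z_free]]] : exists w z,
    [/\ f * z = z, z * f = z, y = w * z /\ (exists b, z = b * y)
      & forall a, a * z = 0 -> a * f = 0].
  have [| |z [fz zf zE z_free]] := primitive_ideal f_prim (left_ideal_mul y).
  - by move=> _ [a ->]; rewrite -mulrA yf.
  - by exists y => //; exists 1; rewrite mul1r.
  have [a yE] : exists a, y = a * z by apply/zE; exists 1; rewrite mul1r.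
  by exists a, z; split=> //; split=> //; apply/zE; exists 1; rewrite mul1r.
pose u := e * w * f; pose v := f * b * e.
have uz : u * z = y by rewrite /u -!mulrA fz -yE ey.
have vy : v * y = z by rewrite /v -!mulrA ey -zE fz.
have vu : v * u = f.
  have : (v * u - f) * z = 0 by rewrite mulrBl -mulrA uz vy fz subrr.
  move/z_free/eqP; rewrite mulrBl subr_eq0 => /eqP.
  by rewrite ff /u -!mulrA ff.
have eu : e * u = u by rewrite /u !mulrA ee.
have uf : u * f = u by rewrite /u -!mulrA ff.
have fv : f * v = v by rewrite /v !mulrA ff.
have ve : v * e = v by rewrite /v -!mulrA ee.
have uv : u * v = e; last first.
  split=> [|a]; first by exists u, v.
  rewrite -/y -uz mulrA => /z_free; rewrite -mulrA uf => au0.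
  by rewrite -uv mulrA au0 mul0r.
case: (e_prim (u * v)) => //.
- by rewrite mulrA -(mulrA u) vu uf.
- by rewrite mulrA eu.
- by rewrite -mulrA ve.
move=> uv0; case/eqP: f0.
by rewrite -ff -vu -mulrA (mulrA u) uv0 mul0r mulr0.
Qed.
End Idempotents.

(** * Chain conditions and decomposition of the identity *)

Section Chains.
Variable R : pzRingType.
Hypothesis R_pli : principal_left_ideals R.

(** The union of the chain is a principal left ideal, and some term of the
    chain contains its generator. *)
Lemma chain_stable (I : nat -> R -> Prop) : (forall m, left_ideal (I m)) ->
    (forall m x, I m x -> I m.+1 x) ->
  exists m, forall x, I m.+1 x -> I m x.
Proof.
move=> hI up; have upD m d x : I m x -> I (m + d)%N x.
  by elim: d => [|d IHd]; rewrite ?addn0 ?addnS // => /IHd/up.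
have [|a aE] := R_pli (I := fun x => exists m, I m x).
  split=> [|a x y [m Ix] [p Iy]]; first by exists 0%N; case: (hI 0%N).
  exists (m + p)%N; apply: (hI _).2; first exact: upD.
  by rewrite addnC; apply: upD.
have [m Ia] : exists m, I m a by apply/aE; exists 1; rewrite mul1r.
exists m => x Ix; have [|d ->] := (aE x).1; first by exists m.+1.
by have := (hI m).2 d a 0 Ia (hI m).1; rewrite addr0.
Qed.

Lemma left_ideal_ann y : left_ideal (fun x : R => x * y = 0).
Proof.
split=> [|a x z x0 z0]; first by rewrite mul0r.
by rewrite mulrDl -mulrA x0 z0 mulr0 addr0.
Qed.

(** The left annihilators of the powers of y increase, so they are stationary
    from some m on.  The element (1 - yx) x^m annihilates y^(m+1), since (1 -
    yx) y = 0; hence it annihilates y^m, and the product is 1 - yx. *)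
Lemma dedekind_finite (x y : R) : x * y = 1 -> y * x = 1.
Proof.
move=> xy1.
have [||m mP] := @chain_stable (fun m z => z * y ^+ m = 0).
- by move=> m; apply: left_ideal_ann.
- by move=> m z; rewrite exprSr mulrA => ->; rewrite mul0r.
have xym j : x ^+ j * y ^+ j = 1.
  elim: j => [|j IHj]; first by rewrite mulr1.
  by rewrite exprSr exprS mulrA -(mulrA _ x) xy1 mulr1.
have E : (1 - y * x) * x ^+ m * y ^+ m = 1 - y * x.
  by rewrite -mulrA xym mulr1.
apply/esym/subr0_eq; rewrite -E; apply: mP.
by rewrite exprSr mulrA E mulrBl mul1r -mulrA xy1 mulr1 subrr.
Qed.

Definition orthogonal_rel (x y : R) := (x * y == 0) && (y * x == 0).

Definition decomposable (e : R) : Prop := exists s : seq R,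
  [/\ {in s, forall x, primitive x}, pairwise orthogonal_rel s
    & \sum_(x <- s) x = e].

Lemma decomposable_summand e s x : {in s, forall x, primitive x} ->
  pairwise orthogonal_rel s -> \sum_(y <- s) y = e -> x \in s ->
  x * e = x /\ e * x = x.
Proof.
move=> prim + <-; elim: s prim => [|y s IHs] //= prim /andP[/allP ys ss].
rewrite big_cons inE mulrDr mulrDl mulr_sumr mulr_suml => /predU1P[->|xs].
  have [-> _ _] := prim y (mem_head _ _).
  by rewrite !big1_seq ?addr0 // => z /andP[_ /ys/andP[/eqP ? /eqP ?]].
have /andP[/eqP -> /eqP ->] := ys _ xs; rewrite !add0r.
rewrite -mulr_sumr -mulr_suml; apply: IHs => // z zs.
by apply: prim; rewrite inE zs orbT.
Qed.

Lemma decomposableD e f : e * f = 0 -> f * e = 0 ->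
  decomposable e -> decomposable f -> decomposable (e + f).
Proof.
move=> ef fe [s [sP so se]] [t [tP to te]]; exists (s ++ t); split.
- by move=> x; rewrite mem_cat => /orP[/sP|/tP].
- rewrite pairwise_cat so to !andbT; apply/allrelP => x y xs yt.
  have [xe ex] := decomposable_summand sP so se xs.
  have [yf fy] := decomposable_summand tP to te yt.
  apply/andP; split; apply/eqP.
    by rewrite -xe -fy mulrA -(mulrA x) ef mulr0 mul0r.
  by rewrite -yf -ex mulrA -(mulrA y) fe mulr0 mul0r.
- by rewrite big_cat /= se te.
Qed.

Lemma decomposable_split e : e * e = e -> ~ decomposable e ->
  exists g, [/\ g * g = g, ~ decomposable g, e * g = g, g * e = g & g <> e].
Proof.
move=> ee e_bad.
have e0 : e != 0.
  by apply/eqP => e0; apply: e_bad; exists [::]; rewrite big_nil e0; split.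
have [f [ff ef fe f0 f_neq]] : exists f,
    [/\ f * f = f, e * f = f, f * e = f, f <> 0 & f <> e].
  apply: contrapT => h; apply: e_bad; exists [:: e]; split=> //.
    move=> x; rewrite inE => /eqP ->; split=> // f ff ef fe.
    have [->|/eqP f0] := eqVneq f 0; first by left.
    by have [->|/eqP fe'] := eqVneq f e; [right|case: h; exists f].
  by rewrite big_seq1.
have fg : f * (e - f) = 0 by rewrite mulrBr fe ff subrr.
have gf : (e - f) * f = 0 by rewrite mulrBl ef ff subrr.
have [f_ok|f_bad] := pselect (decomposable f); last by exists f.
exists (e - f); split.
- by rewrite mulrBr gf subr0 mulrBl ee fe.
- move=> g_ok; apply: e_bad.
  by rewrite -[e](subrK f) addrC; apply: decomposableD.
- by rewrite mulrBr ee ef.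
- by rewrite mulrBl ee fe.
- by move/(congr1 (fun x => e - x)); rewrite opprB addrC subrK subrr.
Qed.

(** If e does not decompose, then [decomposable_split] can be iterated forever.
    The left annihilators of the idempotents so obtained increase strictly: if
    g is a proper summand of h, then 1 - g annihilates g but not h. *)
Lemma idempotent_decomposable e : e * e = e -> decomposable e.
Proof.
move=> ee; apply: contrapT => e_bad.
pose bad g := g * g = g /\ ~ decomposable g.
have [G GP] : {G : R -> R & forall g, bad g ->
    [/\ bad (G g), g * G g = G g, G g * g = G g & G g <> g]}.
  apply: (@choice _ _ (fun g h => bad g ->
    [/\ bad h, g * h = h, h * g = h & h <> g])) => g.
  have [[gg g_bad]|g_ok] := pselect (bad g); last by exists 0.
  by have [h [hh h_bad gh hg hne]] := decomposable_split gg g_bad; exists h.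
have Gbad m : bad (iter m G e) by elim: m => // m /GP[].
have [||m mP] := @chain_stable (fun m z => z * iter m G e = 0).
- by move=> m; apply: left_ideal_ann.
- move=> m z z0; have [_ E _ _] := GP _ (Gbad m).
  by rewrite iterS -E mulrA z0 mul0r.
have [[hh _] _ hg] := GP _ (Gbad m); apply.
apply/esym/subr0_eq; have := mP (1 - iter m.+1 G e).
by rewrite !mulrBl !mul1r hg /= hh subrr; apply.
Qed.

Lemma primitive_decomposition : exists m (e : 'I_m -> R),
  [/\ forall i, primitive (e i), forall i j, i != j -> e i * e j = 0
    & \sum_i e i = 1].
Proof.
have [s [sP so s1]] := idempotent_decomposable (mulr1 1).
exists (size s), (fun i => s`_i); split=> [i|i j ij|].
- by apply: sP; rewrite mem_nth.
- have /(pairwiseP 0) so' := so.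
  have [lt_ij|lt_ji|/val_inj E] := ltngtP i j.
  + by have /andP[/eqP] := so' _ _ (ltn_ord i) (ltn_ord j) lt_ij.
  + by have /andP[_ /eqP] := so' _ _ (ltn_ord j) (ltn_ord i) lt_ji.
  + by rewrite E eqxx in ij.
- by rewrite -s1 (big_nth 0) big_mkord.
Qed.
End Chains.

(** * Corner rings *)

(** An isomorphism from D onto the ring eRe, seen as a map into R.  It lets the
    corner be presented by any ring D, such as a given domain. *)
Record corner_map (D R : pzRingType) (e : R) (phi : D -> R) : Prop := CornerMap {
  corner_mapD : {morph phi : x y / x + y};
  corner_mapM : {morph phi : x y / x * y};
  corner_map1 : phi 1 = e;
  corner_map_inj : injective phi;
  corner_map_surj : forall x, e * x = x -> x * e = x -> exists d, phi d = x }.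

Section CornerMaps.
Variables (D R : pzRingType) (e : R) (phi : D -> R).
Hypothesis phiP : corner_map e phi.
Let phiM := corner_mapM phiP.

Lemma corner_map0 : phi 0 = 0.
Proof. by apply: (addrI (phi 0)); rewrite -(corner_mapD phiP) !addr0. Qed.

Lemma corner_mapN : {morph phi : x / - x}.
Proof.
move=> x; apply: (addrI (phi x)).
by rewrite -(corner_mapD phiP) !subrr corner_map0.
Qed.

Lemma corner_map_l x : e * phi x = phi x.
Proof. by rewrite -(corner_map1 phiP) -phiM mul1r. Qed.

Lemma corner_map_r x : phi x * e = phi x.
Proof. by rewrite -(corner_map1 phiP) -phiM mulr1. Qed.

Lemma corner_map_idem : e * e = e.
Proof. by rewrite -{2}(corner_map1 phiP) corner_map_l (corner_map1 phiP). Qed.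

Lemma corner_map_eq0 x : phi x = 0 -> x = 0.
Proof. by rewrite -corner_map0 => /(corner_map_inj phiP). Qed.
End CornerMaps.

(** A domain has no idempotents other than 0 and 1. *)
Lemma corner_map_primitive (D : nzRingType) (R : pzRingType) (e : R)
  (phi : D -> R) : corner_map e phi -> is_domain D -> primitive e.
Proof.
move=> phiP D_dom; split=> [||f ff ef fe].
- exact: (corner_map_idem phiP).
- apply/eqP; rewrite -(corner_map1 phiP) => /(corner_map_eq0 phiP)/eqP.
  by rewrite oner_eq0.
have [d dE] := corner_map_surj phiP ef fe.
have /D_dom/orP[/eqP d0|/eqP/subr0_eq d1] : d * (d - 1) = 0.
- apply: (corner_map_inj phiP); rewrite (corner_mapM phiP) (corner_mapD phiP).
  rewrite (corner_mapN phiP) (corner_map1 phiP) dE mulrBr ff fe subrr.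
  by rewrite (corner_map0 phiP).
- by left; rewrite -dE d0 (corner_map0 phiP).
- by right; rewrite -dE d1 (corner_map1 phiP).
Qed.

(** Nonzero elements of eRe act injectively on Re by [primitive_schur], so eRe
    is a domain.  For a left ideal I of eRe, the elements x of Re with eRx
    inside I form a left ideal K of R with eK = I.  It is cyclic, K = Rz with
    ez = z, and then I = (eRe) z. *)
Lemma corner_map_pli (D : nzRingType) (R : pzRingType) (e : R)
    (phi : D -> R) : cvs_ideals R -> corner_map e phi -> primitive e ->
  principal_left_ideal_domain D.
Proof.
move=> R_cvs phiP e_prim; have [ee _ _] := e_prim.
split=> [x y xy0|I].
  have [//|y0] := eqVneq y 0; first by rewrite orbT.
  have [|_ h] := primitive_schur R_cvs (x := phi y) e_prim e_prim.
    rewrite (corner_map_l phiP) (corner_map_r phiP); apply: contra y0.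
    by move/eqP/(corner_map_eq0 phiP)/eqP.
  apply/orP; left; apply/eqP/(corner_map_eq0 phiP); rewrite -(corner_map_r phiP).
  apply: h; rewrite (corner_map_l phiP) (corner_map_r phiP) -(corner_mapM phiP).
  by rewrite xy0 (corner_map0 phiP).
have [I0 IP] := lin_closed_submod I.
have IM a x : submod_set I x -> submod_set I (a * x).
  by move=> Ix; have := IP a x 0 Ix I0; rewrite addr0.
pose K (x : R) := x * e = x /\
  forall a, exists2 d, submod_set I d & phi d = e * a * x.
have K_ideal : left_ideal K.
  split; first split=> [|a]; rewrite ?mul0r //.
    by exists 0; rewrite // (corner_map0 phiP) mulr0.
  move=> a x y [xe Kx] [ye Ky]; split=> [|b].
    by rewrite mulrDl -mulrA xe ye.
  have [d Id dE] := Kx (b * a); have [d' Id' d'E] := Ky b.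
  exists (d + d'); first by have := IP 1 d d' Id Id'; rewrite scale1r.
  by rewrite (corner_mapD phiP) dE d'E mulrDr !mulrA.
have [[x Kx x0]|K0] := pselect (exists2 x, K x & x != 0); last first.
  exists 0; apply/seteqP; split=> [d Id|_ [d _ <-]]; last by rewrite mulr0.
  exists 0 => //; rewrite mulr0; apply/esym/(corner_map_eq0 phiP).
  apply: contrapT => /eqP d0; apply: K0; exists (phi d) => //.
  split=> [|a]; first exact: (corner_map_r phiP).
  have [||c cE] := @corner_map_surj _ _ _ _ phiP (e * a * e).
  - by rewrite !mulrA ee.
  - by rewrite -!mulrA ee.
  exists (c * d); first exact: IM.
  by rewrite (corner_mapM phiP) cE -!mulrA (corner_map_l phiP).
have [||z [ez ze Kz z_free]] := primitive_ideal R_cvs e_prim K_ideal.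
- by move=> ? [].
- by exists x.
have [_ /(_ 1)[d0 Id0 d0E]] : K z by apply/Kz; exists 1; rewrite mul1r.
rewrite mulr1 ez in d0E.
exists d0; apply/seteqP; split=> [d Id|_ [a _ <-]]; last exact: IM.
have /Kz[a aE] : K (phi d).
  split=> [|a]; first exact: (corner_map_r phiP).
  have [||c cE] := @corner_map_surj _ _ _ _ phiP (e * a * e).
  - by rewrite !mulrA ee.
  - by rewrite -!mulrA ee.
  exists (c * d); first exact: IM.
  by rewrite (corner_mapM phiP) cE -!mulrA (corner_map_l phiP).
have [||c cE] := @corner_map_surj _ _ _ _ phiP (e * a * e).
- by rewrite !mulrA ee.
- by rewrite -!mulrA ee.
exists c => //; apply: (corner_map_inj phiP).
by rewrite (corner_mapM phiP) cE d0E -!mulrA ez -aE (corner_map_l phiP).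
Qed.

(** The isomorphism is conjugation, d |-> v d u. *)
Lemma associated_corner_iso (D D' R : pzRingType) (e e' : R) (phi : D -> R)
    (phi' : D' -> R) : corner_map e phi -> corner_map e' phi' ->
  associated e e' -> ring_iso D D'.
Proof.
move=> phiP phiP' [u [v [[eu ue'] [e'v ve] uv vu]]].
have [f fE] : {f : D -> D' & forall d, phi' (f d) = v * phi d * u}.
  apply: (@choice _ _ (fun d d' => phi' d' = v * phi d * u)) => d.
  apply: (corner_map_surj phiP'); first by rewrite !mulrA e'v.
  by rewrite -!mulrA ue'.
have [g gE] : {g : D' -> D & forall d, phi (g d) = u * phi' d * v}.
  apply: (@choice _ _ (fun d d' => phi d' = u * phi' d * v)) => d.
  apply: (corner_map_surj phiP); first by rewrite !mulrA eu.
  by rewrite -!mulrA ve.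
have f_add : zmod_morphism f.
  move=> x y; apply: (corner_map_inj phiP'); rewrite (corner_mapD phiP').
  rewrite (corner_mapN phiP') !fE (corner_mapD phiP) (corner_mapN phiP).
  by rewrite mulrBr mulrBl.
have f_mul : monoid_morphism f.
  split=> [|x y]; apply: (corner_map_inj phiP').
    by rewrite fE !(corner_map1 phiP') (corner_map1 phiP) ve vu.
  rewrite (corner_mapM phiP') !fE (corner_mapM phiP) !mulrA.
  by rewrite -(mulrA _ u v) uv -(mulrA _ _ e) (corner_map_r phiP).
exists (HB.pack f (GRing.isZmodMorphism.Build D D' f f_add)
          (GRing.isMonoidMorphism.Build D D' f f_mul) : {rmorphism D -> D'}).
exists g => d.
  apply: (corner_map_inj phiP); rewrite gE fE !mulrA uv -(mulrA _ u) uv.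
  by rewrite (corner_map_l phiP) (corner_map_r phiP).
apply: (corner_map_inj phiP'); rewrite fE gE !mulrA vu -(mulrA _ v) vu.
by rewrite (corner_map_l phiP') (corner_map_r phiP').
Qed.

Section CornerRing.
Variables (R : pzRingType) (e : R) (ee : e * e = e) (e0 : e != 0).

Definition in_corner := [pred x : R | (e * x == x) && (x * e == x)].

(** The proofs are parameters of the type, for the instances to find them. *)
Definition corner of e * e = e & e != 0 : Type := {x : R | x \in in_corner}.
Local Notation C := (corner ee e0).

Lemma in_cornerP x : reflect (e * x = x /\ x * e = x) (x \in in_corner).
Proof. by apply: (iffP andP) => -[/eqP ? /eqP ?]. Qed.

Lemma corner_zmod_closed : zmod_closed in_corner.
Proof.
split=> [|x y /in_cornerP[ex xe] /in_cornerP[ey ye]]; apply/in_cornerP.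
  by rewrite mulr0 mul0r.
by rewrite mulrBr mulrBl ex xe ey ye.
Qed.

HB.instance Definition _ := SubChoice.on C.
HB.instance Definition _ :=
  GRing.SubChoice_isSubZmodule.Build R in_corner C corner_zmod_closed.

Lemma corner_mul_subproof (x y : C) : val x * val y \in in_corner.
Proof.
have /in_cornerP[ex _] := valP x; have /in_cornerP[_ ye] := valP y.
by apply/in_cornerP; rewrite mulrA ex -mulrA ye.
Qed.

Lemma corner_one_subproof : e \in in_corner.
Proof. exact/in_cornerP. Qed.

Definition corner_mul (x y : C) : C :=
  Sub (val x * val y) (corner_mul_subproof x y).
Definition corner_one : C := Sub e corner_one_subproof.

Lemma corner_valD (x y : C) : val (x + y) = val x + val y.
Proof. exact: raddfD. Qed.
Lemma corner_valM (x y : C) : val (corner_mul x y) = val x * val y.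
Proof. exact: SubK. Qed.

Fact corner_mulA : associative corner_mul.
Proof. by move=> x y z; apply: val_inj; rewrite !SubK mulrA. Qed.
Fact corner_mul1 : left_id corner_one corner_mul.
Proof.
by move=> x; apply: val_inj; rewrite !SubK; have /in_cornerP[] := valP x.
Qed.
Fact corner_mulr1 : right_id corner_one corner_mul.
Proof.
by move=> x; apply: val_inj; rewrite !SubK; have /in_cornerP[] := valP x.
Qed.
Fact corner_mulDl : left_distributive corner_mul +%R.
Proof.
move=> x y z; apply: val_inj.
by rewrite corner_valD !corner_valM corner_valD mulrDl.
Qed.
Fact corner_mulDr : right_distributive corner_mul +%R.
Proof.
move=> x y z; apply: val_inj.
by rewrite corner_valD !corner_valM corner_valD mulrDr.
Qed.
Fact corner_one_neq0 : corner_one != 0.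
Proof. by apply: contra e0 => /eqP/(congr1 val); rewrite SubK raddf0 => ->. Qed.

HB.instance Definition _ := GRing.Zmodule_isNzRing.Build C
  corner_mulA corner_mul1 corner_mulr1 corner_mulDl corner_mulDr corner_one_neq0.

Lemma corner_val_map : corner_map e (val : C -> R).
Proof.
split=> [x y|x y|||x ex xe].
- exact: raddfD.
- exact: SubK.
- exact: SubK.
- exact: val_inj.
- have h : x \in in_corner by apply/in_cornerP.
  by exists (Sub x h); rewrite SubK.
Qed.
End CornerRing.

(** * Matrix units *)

(** A system of matrix units up to isomorphism, for several blocks: u i a and v
    i a are mutually inverse isomorphisms between the a-th diagonal idempotent
    u i a * v i a of block i and the idempotent E i common to the block. *)
Record frame (R : pzRingType) (k : nat) (n : 'I_k -> nat) (E : 'I_k -> R)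
    (u v : forall i, 'I_(n i) -> R) : Prop := Frame {
  frame_uE : forall i a, u i a * E i = u i a;
  frame_Ev : forall i a, E i * v i a = v i a;
  frame_vu : forall i a b, v i a * u i b = if a == b then E i else 0;
  frame_uv : \sum_i \sum_a u i a * v i a = 1;
  frame_cross : forall i j x, i != j -> E i * x * E j = 0 }.

Section Frames.
Variables (R : pzRingType) (k : nat) (n : 'I_k -> nat) (E : 'I_k -> R).
Variables (u v : forall i, 'I_(n i) -> R).
Arguments u : clear implicits.
Arguments v : clear implicits.
Hypothesis uvP : frame E u v.


(** The central idempotent of block i. *)
Definition frame_block i : R := \sum_a u i a * v i a.
Local Notation c := frame_block.

Lemma frame_vxu i j a b x : i != j -> v i a * x * u j b = 0.
Proof.
move=> ij; rewrite -(frame_Ev uvP) -(frame_uE uvP) mulrA.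
by rewrite -(mulrA (E i)) -(mulrA (E i)) (frame_cross uvP).
Qed.

Lemma frame_vu_cross i j a b : i != j -> v i a * u j b = 0.
Proof. by move=> ij; rewrite -[v i a]mulr1 frame_vxu. Qed.

Lemma frame_block_sum : \sum_i c i = 1.
Proof. exact: frame_uv uvP. Qed.

Lemma frame_vxc i a x : v i a * x * c i = v i a * x.
Proof.
rewrite -[RHS]mulr1 -frame_block_sum [RHS]mulr_sumr (bigD1 i) //=.
rewrite [X in _ + X]big1 ?addr0 // => j ji.
rewrite /c mulr_sumr big1 // => b _.
by rewrite mulrA frame_vxu ?mul0r // eq_sym.
Qed.

Lemma frame_cxu i b x : c i * (x * u i b) = x * u i b.
Proof.
rewrite -[RHS]mul1r -frame_block_sum [RHS]mulr_suml (bigD1 i) //=.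
rewrite [X in _ + X]big1 ?addr0 // => j ji.
rewrite /c mulr_suml big1 // => a _.
by rewrite -mulrA (mulrA (v j a)) frame_vxu // mulr0.
Qed.

Lemma frame_vc i a : v i a * c i = v i a.
Proof. by rewrite -[v i a]mulr1 frame_vxc. Qed.

Lemma frame_cu i a : c i * u i a = u i a.
Proof. by rewrite -[u i a]mul1r frame_cxu. Qed.

Lemma frame_xE x :
  x = \sum_i \sum_a \sum_b u i a * (v i a * x * u i b) * v i b.
Proof.
rewrite -[LHS]mul1r -frame_block_sum [LHS]mulr_suml; apply: eq_bigr => i _.
rewrite [LHS]mulr_suml; apply: eq_bigr => a _.
rewrite -mulrA -[in LHS]frame_vxc [LHS]mulrA [LHS]mulr_sumr; apply: eq_bigr => b _.
by rewrite !mulrA.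
Qed.

Lemma frame_coord i a b (f : forall j, 'I_(n j) -> 'I_(n j) -> R) :
    E i * f i a b * E i = f i a b ->
  v i a * (\sum_j \sum_c \sum_d u j c * f j c d * v j d) * u i b = f i a b.
Proof.
move=> fE; rewrite mulr_sumr (bigD1 i) //= [X in _ + X]big1 ?addr0 => [|j ji].
  rewrite mulr_sumr (bigD1 a) //= [X in _ + X]big1 ?addr0 => [|c' ca].
    rewrite mulr_sumr mulr_suml (bigD1 b) //= [X in _ + X]big1 ?addr0 => [|d db].
      rewrite -!mulrA (frame_vu uvP) eqxx !mulrA (frame_vu uvP) eqxx.
      exact: fE.
    by rewrite -!mulrA (frame_vu uvP) (negPf db) !mulr0.
  rewrite mulr_sumr big1 // => d _.
  by rewrite !mulrA (frame_vu uvP) eq_sym (negPf ca) !mul0r.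
rewrite mulr_sumr big1 // => c' _; rewrite mulr_sumr big1 // => d _.
by rewrite !mulrA frame_vu_cross ?mul0r // eq_sym.
Qed.

Section CoordinateRings.
Variables (D : 'I_k -> nzRingType) (phi : forall i, D i -> R).
Arguments phi : clear implicits.
Hypothesis phiP : forall i, corner_map (E i) (phi i).

(** An element x is sent to the matrices of its coordinates v i a * x * u i b
    in the corners of the E i. *)
Lemma frame_ring_iso : ring_iso R (matrix_prod n D).
Proof.
have coordE x i a b : exists d, phi i d = v i a * x * u i b.
  apply: (corner_map_surj (phiP i)); first by rewrite !mulrA (frame_Ev uvP).
  by rewrite -!mulrA (frame_uE uvP).
have /all_sig[F FE] : forall x : R, {y : matrix_prod n D |
    forall i a b, phi i (y i a b) = v i a * x * u i b}.
  move=> x.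
  exists (finfun (fun i => \matrix_(a, b) projT1 (cid (coordE x i a b)))).
  by move=> i a b; rewrite ffunE mxE; case: cid.
have F_inj (y z : matrix_prod n D) :
    (forall i a b, phi i (y i a b) = phi i (z i a b)) -> y = z.
  move=> yz; apply: matrix_prodP => i; apply/matrixP => a b.
  exact: (corner_map_inj (phiP i)).
have F_add : zmod_morphism F.
  move=> x y; apply: F_inj => i a b; rewrite matrix_prodD matrix_prodN !mxE.
  rewrite (corner_mapD (phiP i)) (corner_mapN (phiP i)) !FE.
  by rewrite mulrBr mulrBl.
have phi_sum i m (f : 'I_m -> D i) : phi i (\sum_a f a) = \sum_a phi i (f a).
  exact: (big_morph _ (corner_mapD (phiP i)) (corner_map0 (phiP i))).
have F_mul : monoid_morphism F.
  split=> [|x y]; apply: F_inj => i a b; rewrite FE.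
    rewrite matrix_prod1 mxE mulr1 (frame_vu uvP); case: eqP => _ /=.
      by rewrite (corner_map1 (phiP i)).
    by rewrite (corner_map0 (phiP i)).
  rewrite matrix_prodM mxE phi_sum mulrA -frame_vxc mulr_sumr !mulr_suml.
  by apply: eq_bigr => d _; rewrite (corner_mapM (phiP i)) !FE !mulrA.
exists (HB.pack F (GRing.isZmodMorphism.Build R (matrix_prod n D) F F_add)
  (GRing.isMonoidMorphism.Build R (matrix_prod n D) F F_mul)
  : {rmorphism R -> matrix_prod n D}).
exists (fun y : matrix_prod n D =>
  \sum_i \sum_a \sum_b u i a * phi i (y i a b) * v i b) => [x|y] /=.
  rewrite [RHS]frame_xE; do 3 (apply: eq_bigr => ? _).
  by rewrite FE.
apply: F_inj => i a b.
rewrite FE (frame_coord (f := fun j c d => phi j (y j c d))) //.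
by rewrite (corner_map_l (phiP i)) (corner_map_r (phiP i)).
Qed.
End CoordinateRings.
End Frames.

Lemma delta_mx_sandwich (D : nzRingType) n (A : 'M[D]_n) i :
  delta_mx i i *m A *m delta_mx i i = A i i *: delta_mx i i.
Proof.
apply/matrixP => a b; rewrite mxE (bigD1 i) //= big1 ?addr0 => [|c ci].
  rewrite !mxE (bigD1 i) //= big1 ?addr0 => [|c ci].
    rewrite !mxE !eqxx andbT /=; case: (a == i); rewrite ?mul1r //=.
    by rewrite !mul0r mulr0.
  by rewrite !mxE (negPf ci) andbF mul0r.
by rewrite !mxE (negPf ci) mulr0.
Qed.

Section StandardFrame.
Variables (k : nat) (n : 'I_k -> nat) (D : 'I_k -> nzRingType).
Hypothesis n_gt0 : forall i, (0 < n i)%N.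
Local Notation S := (matrix_prod n D).
Local Notation o i := (Ordinal (n_gt0 i)).

Definition std_E i : S := block (delta_mx (o i) (o i)).
Definition std_u i (a : 'I_(n i)) : S := block (delta_mx a (o i)).
Definition std_v i (a : 'I_(n i)) : S := block (delta_mx (o i) a).
Definition std_phi i (d : D i) : S := block (d *: delta_mx (o i) (o i)).

Lemma mul_blocks i (A B : 'M[D i]_(n i)) :
  block A * block B = block (A *m B) :> S.
Proof. by rewrite mul_block block_in. Qed.

Lemma mul_blocks_neq i j (A : 'M[D i]_(n i)) (B : 'M[D j]_(n j)) :
  i != j -> block A * block B = 0 :> S.
Proof. by move=> ij; rewrite mul_block block_out 1?eq_sym // mulmx0 block0. Qed.

Lemma std_frame : frame std_E std_u std_v.
Proof.
split=> [i a|i a|i a b||i j x ij].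
- by rewrite mul_blocks mul_delta_mx.
- by rewrite mul_blocks mul_delta_mx.
- rewrite mul_blocks mul_delta_mx_cond; case: eqP => _ //.
  by rewrite block0.
- rewrite [RHS]sum_blocks; apply: eq_bigr => i _.
  rewrite matrix_prod1 mx1_sum_delta block_sum; apply: eq_bigr => a _.
  by rewrite mul_blocks mul_delta_mx.
- by rewrite mul_block mul_blocks_neq.
Qed.

Lemma std_corner_map i : corner_map (std_E i) (@std_phi i).
Proof.
split=> [x y|x y||x y E|x Ex xE].
- by rewrite /std_phi scalerDl block_is_additive.
- rewrite /std_phi mul_blocks -scalemxAl -[y *: _]mul_scalar_mx mulmxA.
  by rewrite delta_mx_sandwich mxE eqxx mulr1n scalerA.
- by rewrite /std_phi scale1r.
- have := congr1 (fun z : S => (z i : 'M_(n i)) (o i) (o i)) E.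
  by rewrite /std_phi !block_in !mxE !eqxx !mulr1.
- exists ((x i : 'M_(n i)) (o i) (o i)); rewrite /std_phi.
  by rewrite -delta_mx_sandwich -mul_blocks -mul_block Ex xE.
Qed.
End StandardFrame.

Section FrameMorphism.
Variables (R S : pzRingType) (g : {rmorphism S -> R}).
Hypothesis g_bij : bijective g.

Lemma frame_morph k (n : 'I_k -> nat) (E : 'I_k -> S)
    (u v : forall i, 'I_(n i) -> S) : frame E u v ->
  frame (fun i => g (E i)) (fun i a => g (u i a)) (fun i a => g (v i a)).
Proof.
case=> uE Ev vu uv cross; have [f fK gK] := g_bij.
split=> [i a|i a|i a b||i j x ij]; rewrite -?rmorphM ?uE ?Ev ?vu //.
- by case: eqP; rewrite ?rmorph0.
- rewrite -[RHS](rmorph1 g) -uv rmorph_sum; apply: eq_bigr => i _.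
  by rewrite rmorph_sum; apply: eq_bigr => a _; rewrite rmorphM.
- by rewrite -[x]gK -!rmorphM cross // rmorph0.
Qed.

Lemma corner_map_morph (D : pzRingType) e (phi : D -> S) : corner_map e phi ->
  corner_map (g e) (fun x => g (phi x)).
Proof.
case=> pD pM p1 pI pS; have [f fK gK] := g_bij.
split=> [x y|x y||x y /(bij_inj g_bij)/pI//|x ex xe].
- by rewrite pD rmorphD.
- by rewrite pM rmorphM.
- by rewrite p1.
- have [||d dE] := pS (f x); last by exists d; rewrite dE gK.
    by apply: (bij_inj g_bij); rewrite rmorphM gK.
  by apply: (bij_inj g_bij); rewrite rmorphM gK.
Qed.
End FrameMorphism.

Lemma ring_iso_frame (R : pzRingType) k (n : 'I_k -> nat)
    (D : 'I_k -> nzRingType) :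
    (forall i, (0 < n i)%N) -> ring_iso R (matrix_prod n D) ->
  exists E (u v : forall i, 'I_(n i) -> R) (phi : forall i, D i -> R),
    frame E u v /\ forall i, corner_map (E i) (phi i).
Proof.
move=> n0 /ring_iso_sym[g g_bij].
exists (fun i => g (std_E D n0 i)), (fun i a => g (std_u D n0 a)).
exists (fun i a => g (std_v D n0 a)), (fun i d => g (std_phi n0 d)).
split; first exact: (frame_morph g_bij (std_frame D n0)).
by move=> i; apply: (corner_map_morph g_bij (std_corner_map D n0 i)).
Qed.

Section PrimitiveFrames.
Variable R : pzRingType.
Hypothesis R_cvs : cvs_ideals R.

(** A decomposition of 1 into primitive idempotents, sorted into the classes of
    [associated]; each idempotent is linked by (U, V) to the representative of
    its class.  By [primitive_schur] the corners between two classes vanish. *)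
Lemma primitive_frame :
  exists k (n : 'I_k -> nat) E (u v : forall i, 'I_(n i) -> R),
  [/\ forall i, (0 < n i)%N, forall i, primitive (E i) & frame E u v].
Proof.
have [m [e [eP e_orth e1]]] := primitive_decomposition (cvs_principal R_cvs).
have ee i : e i * e i = e i by case: (eP i).
pose r i j := `[< associated (e i) (e j) >].
have r_refl i : r i i by apply/asboolP/associated_refl.
have r_sym i j : r i j = r j i.
  by apply/asboolP/asboolP => /associated_sym.
have r_trans : transitive r.
  by move=> j i l /asboolP ij /asboolP jl; apply/asboolP/(associated_trans ij).
pose rep i := odflt i [pick j | r i j].
have r_rep i : r i (rep i) by rewrite /rep; case: pickP.
have rep_eq i j : r i j -> rep i = rep j.
  move=> ij; rewrite /rep (@eq_pick _ (r i) (r j)).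
    by case: pickP => // /(_ j); rewrite r_refl.
  by move=> l; apply/idP/idP; apply: r_trans; rewrite // r_sym.
have rep_id i : rep (rep i) = rep i by apply/esym/rep_eq.
have /all_sig2[U] : forall i, {u : R | e i * u = u /\ u * e (rep i) = u &
    exists v, [/\ e (rep i) * v = v, v * e i = v,
                  u * v = e i & v * u = e (rep i)]}.
  move=> i; apply: cid2; have /asboolP[u [v [eu [ev1 ev2] uv vu]]] := r_rep i.
  by exists u => //; exists v.
move=> eU UV.
have /all_sig[V VP] i := cid (UV i).
pose Q := [pred i | rep i == i].
exists #|Q|, (fun c => #|[pred i | rep i == enum_val c]|).
pose q (c : 'I_#|Q|) := enum_val c.
exists (fun c => e (q c)), (fun c a => U (enum_val a)).
exists (fun c a => V (enum_val a)).
have q_rep (c : 'I_#|Q|) : rep (q c) = q c by apply/eqP; exact: (enum_valP c).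
have a_rep c (a : 'I_#|[pred i | rep i == enum_val c]|) : rep (enum_val a) = q c.
  by apply/eqP; exact: (enum_valP a).
split=> [c|c|]; [|exact: eP|].
  by apply/card_gt0P; exists (q c); rewrite inE q_rep.
split=> [c a|c a|c a b||c d x cd].
- by rewrite -(a_rep c a); case: (eU (enum_val a)).
- by rewrite -(a_rep c a); case: (VP (enum_val a)).
- have [<-|ab] := eqVneq a b.
    by rewrite -(a_rep c a); case: (VP (enum_val a)).
  have [_ <- _ _] := VP (enum_val a); have [<- _] := eU (enum_val b).
  rewrite mulrA -(mulrA (V _)) e_orth ?mulr0 ?mul0r //.
  by apply: contra ab => /eqP/enum_val_inj ->.
- rewrite -e1 (partition_big rep (mem Q)) => [|i _] /=; last first.
    by rewrite inE rep_id.
  rewrite [RHS]big_enum_val /=; apply: eq_bigr => c _.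
  rewrite -(big_enum_val (fun i => U i * V i)) /=.
  by apply: eq_bigr => i _; case: (VP i).
- apply/eqP; apply: contraNT cd => x0; apply/eqP/enum_val_inj.
  have [cd _] := primitive_schur R_cvs (eP _) (eP _) x0.
  by rewrite -[LHS]q_rep -[RHS]q_rep; apply/rep_eq/asboolP.
Qed.
End PrimitiveFrames.

(** * Comparison of two systems of matrix units *)

(** Adding 1 - c to x and y turns the equations in cRc into equations in R. *)
Lemma dedekind_finite_corner (R : pzRingType) (c x y : R) :
    principal_left_ideals R -> c * c = c -> c * x = x -> x * c = x ->
    c * y = y -> y * c = y -> x * y = c ->
  y * x = c.
Proof.
move=> R_pli cc cx xc cy yc xy.
have zc z : z * c = z -> z * (1 - c) = 0.
  by rewrite mulrBr mulr1 => ->; rewrite subrr.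
have cz z : c * z = z -> (1 - c) * z = 0.
  by rewrite mulrBl mul1r => ->; rewrite subrr.
have dd : (1 - c) * (1 - c) = 1 - c by rewrite mulrBr mulr1 cz // subr0.
have cd : c + (1 - c) = 1 by rewrite addrC subrK.
move: (1 - c) zc cz dd cd => d zc cz dd cd.
have E : (x + d) * (y + d) = 1.
  by rewrite mulrDl !mulrDr xy dd zc // cz // addr0 add0r.
have := dedekind_finite R_pli E.
rewrite mulrDl !mulrDr dd zc // cz // addr0 add0r => yxE.
by apply: (addIr d); rewrite yxE cd.
Qed.

Section TwoFrames.
Variables (R : pzRingType).
Hypothesis R_cvs : cvs_ideals R.
Variables (k : nat) (n : 'I_k -> nat) (E : 'I_k -> R).
Variables (u v : forall i, 'I_(n i) -> R).
Arguments u : clear implicits.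
Arguments v : clear implicits.
Hypothesis uvP : frame E u v.
Hypothesis E_prim : forall i, primitive (E i).
Variables (k' : nat) (n' : 'I_k' -> nat) (E' : 'I_k' -> R).
Variables (u' v' : forall i, 'I_(n' i) -> R).
Arguments u' : clear implicits.
Arguments v' : clear implicits.
Hypothesis uvP' : frame E' u' v'.
Hypothesis E'_prim : forall i, primitive (E' i).

Lemma frame_associated_inj i j : associated (E i) (E j) -> i = j.
Proof.
move=> [p [q [[Ep pE] _ pq _]]]; apply/eqP; apply: contraT => ij.
have [_ /eqP[]] := E_prim i.
by rewrite -pq -pE -Ep (frame_cross uvP) // mul0r.
Qed.

Lemma frame_not_associated i j x : ~ associated (E i) (E' j) ->
  E i * x * E' j = 0.
Proof.
move=> h; apply/eqP; apply: contrapT => /negP x0; apply: h.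
by have [] := primitive_schur R_cvs (E_prim i) (E'_prim j) x0.
Qed.

(** E i cannot annihilate all idempotents of the second system, as they add up
    to 1. *)
Lemma frame_partner i : exists j, associated (E i) (E' j).
Proof.
apply: contrapT => h; have [_ /eqP[]] := E_prim i.
rewrite -[LHS]mulr1 -(frame_uv uvP') mulr_sumr big1 // => j _.
rewrite mulr_sumr big1 // => b _.
rewrite mulrA -(frame_uE uvP') mulrA frame_not_associated ?mul0r // => ij.
by apply: h; exists j.
Qed.

Lemma frame_blocks_disjoint i j : ~ associated (E i) (E' j) ->
  frame_block u v i * frame_block u' v' j = 0.
Proof.
move=> h; rewrite mulr_suml big1 // => a _; rewrite mulr_sumr big1 // => b _.
have vu0 : v i a * u' j b = 0.
  rewrite -(frame_Ev uvP) -(frame_uE uvP') mulrA -(mulrA (E i)).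
  exact: frame_not_associated.
by rewrite mulrA -(mulrA (u i a)) vu0 mulr0 mul0r.
Qed.
End TwoFrames.

Section Uniqueness.
Variables (R : pzRingType).
Hypothesis R_cvs : cvs_ideals R.
Variables (k : nat) (n : 'I_k -> nat) (E : 'I_k -> R).
Variables (u v : forall i, 'I_(n i) -> R).
Arguments u : clear implicits.
Arguments v : clear implicits.
Hypothesis uvP : frame E u v.
Hypothesis E_prim : forall i, primitive (E i).
Variables (k' : nat) (n' : 'I_k' -> nat) (E' : 'I_k' -> R).
Variables (u' v' : forall i, 'I_(n' i) -> R).
Arguments u' : clear implicits.
Arguments v' : clear implicits.
Hypothesis uvP' : frame E' u' v'.
Hypothesis E'_prim : forall i, primitive (E' i).

Lemma frame_block_eq i j : associated (E i) (E' j) ->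
  frame_block u v i = frame_block u' v' j.
Proof.
move=> ij; transitivity (frame_block u v i * frame_block u' v' j).
  rewrite -[LHS]mulr1 -(frame_block_sum uvP') [LHS]mulr_sumr (bigD1 j) //=.
  rewrite big1 ?addr0 // => j' j'j.
  apply: (frame_blocks_disjoint R_cvs uvP E_prim uvP' E'_prim) => ij'.
  case/eqP: j'j; apply: (frame_associated_inj uvP' E'_prim).
  exact: associated_trans (associated_sym ij') ij.
rewrite -[RHS]mul1r -(frame_block_sum uvP) [RHS]mulr_suml [RHS](bigD1 i) //=.
rewrite big1 ?addr0 // => i' i'i.
apply: (frame_blocks_disjoint R_cvs uvP E_prim uvP' E'_prim) => i'j.
case/eqP: i'i; apply: (frame_associated_inj uvP E_prim).
exact: associated_trans i'j (associated_sym ij).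
Qed.

(** Suppose n i < n' j.  The isomorphism (p, q) between E i and E' j matches
    the n i idempotents of the first block with the first n i ones of the
    second.  This defines x and y with xy equal to the common block idempotent
    c, and yx equal to the sum of only n i of the n' j idempotents that make up
    c; but yx = c by Dedekind finiteness. *)
Lemma frame_rank_le i j : associated (E i) (E' j) -> (n' j <= n i)%N.
Proof.
move=> ij; rewrite leqNgt; apply/negP => lt_nm.
have [p [q [[Ep pE] [Eq qE] pq qp]]] := ij.
pose w := widen_ord (ltnW lt_nm).
have w_inj : injective w by move=> a b /(congr1 val)/= /val_inj.
pose x := \sum_a u i a * p * v' j (w a).
pose y := \sum_a u' j (w a) * q * v i a.
pose c := frame_block u v i.
have cE : c = frame_block u' v' j := frame_block_eq ij.
have cx : c * x = x.
  rewrite mulr_sumr; apply: eq_bigr => a _.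
  by rewrite -!mulrA [c * _]mulrA (frame_cu uvP).
have xc : x * c = x.
  rewrite mulr_suml; apply: eq_bigr => a _.
  by rewrite -!mulrA cE (frame_vc uvP').
have cy : c * y = y.
  rewrite mulr_sumr; apply: eq_bigr => a _.
  by rewrite -!mulrA cE [_ * (u' _ _ * _)]mulrA (frame_cu uvP').
have yc : y * c = y.
  rewrite mulr_suml; apply: eq_bigr => a _.
  by rewrite -!mulrA (frame_vc uvP).
have cc : c * c = c.
  rewrite {2 3}/c /frame_block mulr_sumr; apply: eq_bigr => a _.
  by rewrite mulrA (frame_cu uvP).
have xy : x * y = c.
  rewrite mulr_suml; apply: eq_bigr => a _.
  rewrite mulr_sumr (bigD1 a) //= big1 ?addr0 => [|b ba].
    rewrite -!mulrA (mulrA (v' j _)) (frame_vu uvP') eqxx (mulrA (E' j)) Eq.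
    by rewrite (mulrA p) pq (frame_Ev uvP).
  rewrite -!mulrA (mulrA (v' j _)) (frame_vu uvP') (inj_eq w_inj) eq_sym.
  by rewrite (negPf ba) !mul0r !mulr0.
have yx := dedekind_finite_corner (cvs_principal R_cvs) cc cx xc cy yc xy.
pose b : 'I_(n' j) := Ordinal lt_nm.
have vb0 : v' j b = 0.
  rewrite -(frame_vc uvP') -cE -yx mulrA.
  suff -> : v' j b * y = 0 by rewrite mul0r.
  rewrite mulr_sumr big1 // => a _.
  rewrite !mulrA (frame_vu uvP'); case: eqP => [ba|_]; last by rewrite !mul0r.
  by have := ltn_ord a; rewrite -[X in (X < _)%N]/(val (w a)) -ba ltnn.
have [_ /eqP[]] := E'_prim j.
by have := frame_vu uvP' b b; rewrite eqxx vb0 mul0r.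
Qed.
End Uniqueness.

(** * The structure theorem *)

Local Close Scope ring_scope.

Theorem theorem3p13 (R : nzRingType) :
  (left_completely_virtually_semisimple R <->
   exists (k : nat) (n : 'I_k -> nat) (D : 'I_k -> nzRingType),
     [/\ 0 < k, forall i, 0 < n i,
         forall i, principal_left_ideal_domain (D i)
       & ring_iso R (matrix_prod n D)]) /\
  (forall (k : nat) (n : 'I_k -> nat) (D : 'I_k -> nzRingType)
          (r : nat) (m : 'I_r -> nat) (D' : 'I_r -> nzRingType),
     0 < k -> (forall i, 0 < n i) ->
     (forall i, principal_left_ideal_domain (D i)) ->
     ring_iso R (matrix_prod n D) ->
     0 < r -> (forall j, 0 < m j) ->
     (forall j, principal_left_ideal_domain (D' j)) ->
     ring_iso R (matrix_prod m D') ->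
     exists (ekr : k = r) (xi : {perm 'I_k}), forall i : 'I_k,
       n i = m (cast_ord ekr (xi i)) /\
       ring_iso (D i) (D' (cast_ord ekr (xi i)))).
Proof.
have cvs_prod k (n : 'I_k -> nat) (D : 'I_k -> nzRingType) :
    (forall i, principal_left_ideal_domain (D i)) ->
    ring_iso R (matrix_prod n D) -> cvs_ideals R.
  move=> D_pli /cvs_ideals_iso; apply; apply: cvs_matrix_prod => i.
    by case: (D_pli i).
  exact: pli_principal.
split.
  split=> [/cvs_idealsP R_cvs|[k [n [D [_ _ D_pli RD]]]]]; last first.
    by apply/cvs_idealsP; apply: cvs_prod RD.
  have [k [n [E [u [v [n0 E_prim uvP]]]]]] := primitive_frame R_cvs.
  have ee i : (E i * E i)%R = E i by case: (E_prim i).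
  have e0 i : E i != 0%R by case: (E_prim i).
  have phiP i := corner_val_map (ee i) (e0 i).
  exists k, n, (fun i => corner (ee i) (e0 i) : nzRingType); split=> //.
  - case: k n E u v n0 E_prim uvP {ee e0 phiP} => // n E u v _ _ uvP.
    have := frame_uv uvP; rewrite big_ord0 => /esym/eqP.
    by rewrite oner_eq0.
  - by move=> i; apply: corner_map_pli R_cvs (phiP i) (E_prim i).
  - exact: (frame_ring_iso uvP phiP).
move=> k n D r m D' _ n0 D_pli RD _ m0 D'_pli RD'.
have R_cvs := cvs_prod _ _ _ D_pli RD.
have [E [u [v [phi [uvP phiP]]]]] := ring_iso_frame n0 RD.
have [E' [u' [v' [phi' [uvP' phiP']]]]] := ring_iso_frame m0 RD'.
have E_prim i := corner_map_primitive (phiP i) (D_pli i).1.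
have E'_prim i := corner_map_primitive (phiP' i) (D'_pli i).1.
have [s sP] := choice (frame_partner R_cvs E_prim uvP' E'_prim).
have [t tP] := choice (frame_partner R_cvs E'_prim uvP E_prim).
have s_inj : injective s.
  move=> i j sij; apply: (frame_associated_inj uvP E_prim).
  by apply: associated_trans (sP i) _; rewrite sij; apply: associated_sym.
have t_inj : injective t.
  move=> i j tij; apply: (frame_associated_inj uvP' E'_prim).
  by apply: associated_trans (tP i) _; rewrite tij; apply: associated_sym.
have ekr : k = r.
  apply/eqP; rewrite eqn_leq.
  have := leq_card s s_inj; have := leq_card t t_inj.
  by rewrite !card_ord => -> ->.
pose s' i := cast_ord (esym ekr) (s i).
have s'_inj : injective s' by move=> i j /cast_ord_inj/s_inj.
exists ekr, (perm s'_inj) => i; rewrite permE /s' cast_ordKV; split.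
  apply/eqP; rewrite eqn_leq.
  rewrite (frame_rank_le R_cvs uvP E_prim uvP' E'_prim (sP i)).
  by rewrite (frame_rank_le R_cvs uvP' E'_prim uvP E_prim (associated_sym (sP i))).
exact: associated_corner_iso (phiP i) (phiP' (s i)) (sP i).
Qed.
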